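(* Let $(K,\mathsf J)$ be a 2-site. Then there is a bicategory $K_{\mathsf J}$ with the same objects as $K$, with $\mathsf J$-fractions as 1-arrows and maps of $\mathsf J$-fractions as 2-arrows (with the identities, vertical composition, composition of fractions, whiskerings, unitors and associators described in the context).
   Context: **Conventions.** Composition of 1-arrows is in function order; $1_f\circ a$ and $a\circ 1_f$ denote whiskering. A 1-arrow $f\colon x\to y$ is *ff* if for all $g,h\colon w\to x$ and every $\widetilde a\colon f\circ g\Rightarrow f\circ h$ there is a unique $a\colon g\Rightarrow h$ with $\widetilde a=1_f\circ a$. A 1-arrow $j\colon u\to x$ is *co-ff* if for all $g,h\colon x\to y$ and every $\widetilde a\colon g\circ j\Rightarrow h\circ j$ there is a unique $a\colon g\Rightarrow h$ with $\widetilde a=a\circ 1_j$. **2-site.** A 2-site $(K,\mathsf J)$ is a 2-category $K$ with a class $\mathsf J$ of 1-arrows that contains all identities, is closed under composition, such that the strict pullback of an element of $\mathsf J$ along any 1-arrow exists and is again in $\mathsf J$, and such that every element of $\mathsf J$ is both ff and co-ff. All pullbacks are strict; specified pullbacks are given, and the pullback of an identity 1-arrow is an identity 1-arrow (so $u\times_{f,y,\mathrm{id}}y=u$ and $x\times_{\mathrm{id},x,j}u=u$). **Unique lifts.** If $p\colon u\to a$ is ff and $k,l\colon b\to u$ satisfy $p\circ k=p\circ l$, there is a unique 2-arrow $k\Rightarrow l$ whose whiskering with $p$ is the identity; this is called the canonical lift of the identity through $p$. **Fractions and their maps.** A *$\mathsf J$-fraction* $(j,f)$ from $x$ to $y$ is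 a span $x\xleftarrow{j}u\xrightarrow{f}y$ with $j\in\mathsf J$. A *map of $\mathsf J$-fractions* $(j,f)\Rightarrow(k,g)$, where $x\xleftarrow{k}v\xrightarrow{g}y$, is a 2-arrow $f\circ\mathrm{pr}_1\Rightarrow g\circ\mathrm{pr}_2\colon u\times_x v\to y$ in $K$ (source and target fractions being part of the data). The identity on $(j,f)$ is $1_f\circ\ell_j$, with $\ell_j\colon\mathrm{pr}_1\Rightarrow\mathrm{pr}_2\colon u\times_xu\to u$ the canonical lift of the identity through $j$. The vertical composite $t_1+t_2$ of $t_1\colon(j_1,f_1)\Rightarrow(j_2,f_2)$ and $t_2\colon(j_2,f_2)\Rightarrow(j_3,f_3)$ (apexes $u_1,u_2,u_3$) is the unique 2-arrow on $u_1\times_xu_3$ whose whiskering with $\mathrm{pr}_{13}\colon u_1\times_xu_2\times_xu_3\to u_1\times_xu_3$ (which is in $\mathsf J$) is $t_1\circ1_{\mathrm{pr}_{12}}$ followed by $t_2\circ 1_{\mathrm{pr}_{23}}$. **Composition of fractions.** The composite $(l,h)\circ(j,f)$ of $x\xleftarrow{j}u\xrightarrow{f}y$ and $y\xleftarrow{l}w\xrightarrow{h}z$ is the span $x\leftarrow u\times_yw\to z$ with legs $j\circ\mathrm{pr}_1$, $h\circ\mathrm{pr}_2$. Identity 1-arrows are $(\mathrm{id}_x,\mathrm{id}_x)$. **Right whiskering** of $t\colon(j,f)\Rightarrow(k,g)$ (apexes $u,v$) by $y\xleftarrow{l}w\xrightarrow{h}z$: on $P=(u\times_yw)\times_x(v\times_yw)$,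 let $\rho$ be the unique 2-arrow between the two projections $P\to w$ (first to second) with $1_l\circ\rho=t\circ1_{P\to u\times_xv}$; the whiskering is $1_h\circ\rho$. **Left whiskering** by $x\xleftarrow{j}u\xrightarrow{f}y$ of $a\colon(k_1,g_1)\Rightarrow(k_2,g_2)$, where $y\xleftarrow{k_i}v_i\xrightarrow{g_i}z$, is whiskering by $(\mathrm{id}_u,f)$ followed by whiskering by $(j,\mathrm{id}_u)$. Case I: whiskering by $(\mathrm{id}_u,f)$ is the 2-arrow $a\circ1_\pi$, with $\pi\colon (u\times_yv_1)\times_u(u\times_yv_2)\cong u\times_y(v_1\times_yv_2)\to v_1\times_yv_2$ the projection. Case II: for $\mathsf J$-fractions $u\xleftarrow{k_i}v_i\xrightarrow{g_i}z$ ($i=1,2$) and $a\colon(k_1,g_1)\Rightarrow(k_2,g_2)$, put $v_{12}=v_1\times_uv_2$, $V_{12}=v_1\times_xv_2$ and $c\colon v_{12}\to V_{12}$ the canonical map; whiskering by $(j,\mathrm{id}_u)$ is the unique 2-arrow $\lambda\colon g_1\circ\mathrm{pr}_1\Rightarrow g_2\circ\mathrm{pr}_2\colon V_{12}\to z$ whose whiskering with $\mathrm{pr}_2\colon v_{12}\times_xV_{12}\to V_{12}$ is the vertical composite $g_1\mathrm{pr}_1\mathrm{pr}_2\Rightarrow g_1\mathrm{pr}_1c\,\mathrm{pr}_1\Rightarrow g_2\mathrm{pr}_2c\,\mathrm{pr}_1\Rightarrow g_2\mathrm{pr}_2\mathrm{pr}_2$, the middle 2-arrow being $a\circ1_{\mathrm{pr}_1}$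 and the outer ones whiskerings of the canonical lifts of the identity $\mathrm{pr}_2\Rightarrow c\circ\mathrm{pr}_1$, $c\circ\mathrm{pr}_1\Rightarrow\mathrm{pr}_2$ through $V_{12}\to x$. **Remaining structure.** Horizontal composition of 2-arrows is obtained from left and right whiskering and vertical composition. Composition with identity fractions leaves a fraction unchanged, and the unitors are identity 2-arrows. The associator $[(l,h)\circ(k,g)]\circ(j,f)\Rightarrow(l,h)\circ[(k,g)\circ(j,f)]$ for composable fractions with apexes $u,v,w$ is induced by the canonical isomorphism $\alpha\colon u\times_{x_2}(v\times_{x_3}w)\to(u\times_{x_2}v)\times_{x_3}w$: writing $F$ for the forward leg of the target fraction, it is $1_F$ whiskered with the canonical lift $\alpha\circ\mathrm{pr}_1\Rightarrow\mathrm{pr}_2$ of the identity through the backward leg of the target fraction. *)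

(* Defs.v *)
From Stdlib Require Import ProofIrrelevance.

Set Implicit Arguments.
Unset Strict Implicit.
Unset Printing Implicit Defensive.

(** * Bicategories *)

(* The part of a bicategory that involves no operation on 2-arrows.  Composition
   of 1-arrows is in function order, and is not required to be associative. *)
Record two_graph := TwoGraph {
  ob : Type;
  hom : ob -> ob -> Type;
  cell : forall x y : ob, hom x y -> hom x y -> Type;
  id1 : forall x : ob, hom x x;
  comp : forall x y z : ob, hom y z -> hom x y -> hom x z
}.

Arguments hom {t} x y.
Arguments cell {t x y} f g.
Arguments id1 {t} x.
Arguments comp {t x y z} g f.

Declare Scope bicat_scope.
Delimit Scope bicat_scope with bicat.
Local Open Scope bicat_scope.

Notation "g ∘ f" := (comp g f) (at level 40, left associativity) : bicat_scope.
Notation "f ⇒ g" := (cell f g) (at level 70, no associativity) : bicat_scope.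

(* [f ◁ a] is 1_f ∘ a and [a ▷ f] is a ∘ 1_f; vertical composition [a • b] is in
   diagrammatic order (a followed by b).  The horizontal composite of
   a : f ⇒ f' and b : g ⇒ g' is either side of [interchange]. *)
Class bicat_ops (G : two_graph) := BicatOps {
  id2 : forall (x y : ob G) (f : hom x y), f ⇒ f;
  vcomp : forall (x y : ob G) (f g h : hom x y), f ⇒ g -> g ⇒ h -> f ⇒ h;
  lwhisk : forall (x y z : ob G) (f : hom y z) (g h : hom x y),
    g ⇒ h -> f ∘ g ⇒ f ∘ h;
  rwhisk : forall (x y z : ob G) (g h : hom y z),
    g ⇒ h -> forall f : hom x y, g ∘ f ⇒ h ∘ f;
  lunitor : forall (x y : ob G) (f : hom x y), id1 y ∘ f ⇒ f;
  runitor : forall (x y : ob G) (f : hom x y), f ∘ id1 x ⇒ f;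
  associator : forall (w x y z : ob G)
    (h : hom y z) (g : hom x y) (f : hom w x), (h ∘ g) ∘ f ⇒ h ∘ (g ∘ f)
}.

Arguments id2 {G _ x y} f.
Arguments vcomp {G _ x y f g h} _ _.
Arguments lwhisk {G _ x y z} f {g h} _.
Arguments rwhisk {G _ x y z g h} _ f.
Arguments lunitor {G _ x y} f.
Arguments runitor {G _ x y} f.
Arguments associator {G _ w x y z} h g f.

Notation "a • b" := (vcomp a b) (at level 50, left associativity) : bicat_scope.
Notation "f ◁ a" := (lwhisk f a) (at level 45, no associativity) : bicat_scope.
Notation "a ▷ f" := (rwhisk a f) (at level 45, no associativity) : bicat_scope.

Definition is_iso (G : two_graph) (B : bicat_ops G) (x y : ob G)
  (f g : hom x y) (a : f ⇒ g) : Prop :=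
  exists b : g ⇒ f, a • b = id2 f /\ b • a = id2 g.

Arguments is_iso {G _ x y f g} a.

Record is_bicategory (G : two_graph) (B : bicat_ops G) : Prop := IsBicategory {
  vcomp_id_l : forall (x y : ob G) (f g : hom x y) (a : f ⇒ g),
    id2 f • a = a;
  vcomp_id_r : forall (x y : ob G) (f g : hom x y) (a : f ⇒ g),
    a • id2 g = a;
  vcomp_assoc : forall (x y : ob G) (f g h k : hom x y)
    (a : f ⇒ g) (b : g ⇒ h) (c : h ⇒ k),
    a • (b • c) = (a • b) • c;

  lwhisk_id : forall (x y z : ob G) (f : hom y z) (g : hom x y),
    f ◁ id2 g = id2 (f ∘ g);
  lwhisk_vcomp : forall (x y z : ob G) (f : hom y z) (g h k : hom x y)
    (a : g ⇒ h) (b : h ⇒ k),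
    f ◁ (a • b) = f ◁ a • f ◁ b;
  rwhisk_id : forall (x y z : ob G) (g : hom y z) (f : hom x y),
    id2 g ▷ f = id2 (g ∘ f);
  rwhisk_vcomp : forall (x y z : ob G) (g h k : hom y z)
    (a : g ⇒ h) (b : h ⇒ k) (f : hom x y),
    (a • b) ▷ f = a ▷ f • b ▷ f;
  interchange : forall (x y z : ob G) (f f' : hom x y) (g g' : hom y z)
    (a : f ⇒ f') (b : g ⇒ g'),
    g ◁ a • b ▷ f' = b ▷ f • g' ◁ a;

  lunitor_natural : forall (x y : ob G) (f g : hom x y) (a : f ⇒ g),
    id1 y ◁ a • lunitor g = lunitor f • a;
  runitor_natural : forall (x y : ob G) (f g : hom x y) (a : f ⇒ g),
    a ▷ id1 x • runitor g = runitor f • a;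
  associator_natural_r : forall (w x y z : ob G)
    (h : hom y z) (g : hom x y) (f f' : hom w x) (a : f ⇒ f'),
    (h ∘ g) ◁ a • associator h g f' = associator h g f • h ◁ (g ◁ a);
  associator_natural_m : forall (w x y z : ob G)
    (h : hom y z) (g g' : hom x y) (f : hom w x) (a : g ⇒ g'),
    (h ◁ a) ▷ f • associator h g' f = associator h g f • h ◁ (a ▷ f);
  associator_natural_l : forall (w x y z : ob G)
    (h h' : hom y z) (g : hom x y) (f : hom w x) (a : h ⇒ h'),
    (a ▷ g) ▷ f • associator h' g f = associator h g f • a ▷ (g ∘ f);

  lunitor_iso : forall (x y : ob G) (f : hom x y), is_iso (lunitor f);
  runitor_iso : forall (x y : ob G) (f : hom x y), is_iso (runitor f);
  associator_iso : forall (w x y z : ob G)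
    (h : hom y z) (g : hom x y) (f : hom w x), is_iso (associator h g f);

  triangle : forall (x y z : ob G) (g : hom y z) (f : hom x y),
    associator g (id1 y) f • g ◁ lunitor f = runitor g ▷ f;
  pentagon : forall (v w x y z : ob G)
    (k : hom y z) (h : hom x y) (g : hom w x) (f : hom v w),
    associator (k ∘ h) g f • associator k h (g ∘ f) =
    associator k h g ▷ f • associator k (h ∘ g) f
      • k ◁ associator h g f
}.

(* The identity 2-arrow between 1-arrows that are equal, but possibly not
   convertible. *)
Definition idcell (G : two_graph) (B : bicat_ops G) (x y : ob G)
  (f g : hom x y) (e : f = g) : f ⇒ g :=
  match e in _ = g' return f ⇒ g' with eq_refl => id2 f end.

Arguments idcell {G _ x y f g} e.

(* [a ~= b] is the equality a = b of 2-arrows whose sources, and targets, are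
   equal but possibly not convertible. *)
Inductive cell_eq (G : two_graph) (x y : ob G) (f g : hom x y) (a : f ⇒ g) :
  forall f' g' : hom x y, f' ⇒ g' -> Prop :=
| cell_eq_refl : cell_eq a a.

Notation "a ~= b" := (cell_eq a b) (at level 70, no associativity) : bicat_scope.

(* Vertical composite of 2-arrows composable up to an equality of 1-arrows. *)
Definition vcomp_along (G : two_graph) (B : bicat_ops G) (x y : ob G)
  (f g g' h : hom x y) (e : g = g') (a : f ⇒ g) (b : g' ⇒ h) : f ⇒ h :=
  a • idcell e • b.

Arguments vcomp_along {G _ x y f g g' h} e a b.

(** * 2-categories *)

Record two_category := TwoCategory {
  two_graph_of :> two_graph;
  two_ops : bicat_ops two_graph_of;
  two_laws : is_bicategory two_ops;
  comp_id_l : forall (x y : ob two_graph_of) (f : hom x y), id1 y ∘ f = f;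
  comp_id_r : forall (x y : ob two_graph_of) (f : hom x y), f ∘ id1 x = f;
  comp_assoc : forall (w x y z : ob two_graph_of)
    (h : hom y z) (g : hom x y) (f : hom w x), (h ∘ g) ∘ f = h ∘ (g ∘ f);
  lunitor_strict : forall (x y : ob two_graph_of) (f : hom x y),
    lunitor f = idcell (comp_id_l f);
  runitor_strict : forall (x y : ob two_graph_of) (f : hom x y),
    runitor f = idcell (comp_id_r f);
  associator_strict : forall (w x y z : ob two_graph_of)
    (h : hom y z) (g : hom x y) (f : hom w x),
    associator h g f = idcell (comp_assoc h g f)
}.

#[export] Existing Instance two_ops.

Section TwoCategory.
Variable K : two_category.

Definition is_ff (x y : ob K) (f : hom x y) : Prop :=
  forall (w : ob K) (g h : hom w x) (a' : f ∘ g ⇒ f ∘ h),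
  exists! a : g ⇒ h, a' = f ◁ a.

Definition is_coff (u x : ob K) (j : hom u x) : Prop :=
  forall (y : ob K) (g h : hom x y) (a' : g ∘ j ⇒ h ∘ j),
  exists! a : g ⇒ h, a' = a ▷ j.

(* The last clause is the two-dimensional universal property.  It follows from
   the one-dimensional one as soon as j and p are ff, which is the case for the
   pullbacks of a 2-site. *)
Definition is_strict_pullback (x y u P : ob K)
  (f : hom x y) (j : hom u y) (p : hom P x) (q : hom P u) : Prop :=
  f ∘ p = j ∘ q /\
  (forall (w : ob K) (a : hom w x) (b : hom w u), f ∘ a = j ∘ b ->
     exists! h : hom w P, p ∘ h = a /\ q ∘ h = b) /\
  (forall (w : ob K) (h k : hom w P)
     (s : p ∘ h ⇒ p ∘ k) (t : q ∘ h ⇒ q ∘ k), f ◁ s ~= j ◁ t ->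
     exists! r : h ⇒ k, p ◁ r = s /\ q ◁ r = t).

Definition is_canonical_lift (u a b : ob K) (p : hom u a) (k l : hom b u)
  (r : k ⇒ l) : Prop :=
  unique (fun r' : k ⇒ l => p ◁ r' ~= id2 (p ∘ k)) r.

Record span (x u : ob K) := Span {
  apex : ob K;
  pr1 : hom apex x;
  pr2 : hom apex u
}.

End TwoCategory.

Arguments span {K} x u.
Arguments Span {K x u apex} pr1 pr2.
Arguments pr1 {K x u} s.
Arguments pr2 {K x u} s.

(** * 2-sites *)

Record two_site := TwoSite {
  site_cat :> two_category;
  J : forall x y : ob site_cat, hom x y -> Prop;
  J_id : forall x : ob site_cat, J (id1 x);
  J_comp : forall (x y z : ob site_cat) (g : hom y z) (f : hom x y),
    J g -> J f -> J (g ∘ f);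
  pb : forall (x y u : ob site_cat) (f : hom x y) (j : hom u y),
    J j -> span x u;
  pb_pullback : forall (x y u : ob site_cat) (f : hom x y) (j : hom u y)
    (Jj : J j), is_strict_pullback f j (pr1 (pb f Jj)) (pr2 (pb f Jj));
  J_pullback : forall (x y u P : ob site_cat) (f : hom x y) (j : hom u y)
    (p : hom P x) (q : hom P u), is_strict_pullback f j p q -> J j -> J p;
  pb_id_r : forall (u y : ob site_cat) (f : hom u y) (J1 : J (id1 y)),
    pb f J1 = Span (id1 u) f;
  pb_id_l : forall (u x : ob site_cat) (j : hom u x) (Jj : J j),
    pb (id1 x) Jj = Span j (id1 u);
  J_ff : forall (x y : ob site_cat) (j : hom x y), J j -> is_ff j;
  J_coff : forall (x y : ob site_cat) (j : hom x y), J j -> is_coff j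
}.

Arguments J {t x y} _.
Arguments pb {t x y u} f {j} Jj.

(** * Fractions *)

Section Fractions.
Variable S : two_site.

Lemma J_pr1 (x y u : ob S) (f : hom x y) (j : hom u y) (Jj : J j) :
  J (pr1 (pb f Jj)).
Proof. exact (J_pullback (pb_pullback f Jj) Jj). Qed.

Record fraction (x y : ob S) := Fraction {
  fapex : ob S;
  back : hom fapex x;
  fwd : hom fapex y;
  J_back : J back
}.

(* u ×_x v, for fractions with apexes u and v. *)
Definition meet (x y z : ob S) (p : fraction x y) (q : fraction x z) :
  span (fapex p) (fapex q) := pb (back p) (J_back q).

(* u ×_y w, for composable fractions with apexes u and w. *)
Definition link (x y z : ob S) (p : fraction x y) (q : fraction y z) :
  span (fapex p) (fapex q) := pb (fwd p) (J_back q).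

Definition fraction_map (x y : ob S) (p q : fraction x y) : Type :=
  fwd p ∘ pr1 (meet p q) ⇒ fwd q ∘ pr2 (meet p q).

Definition id_fraction (x : ob S) : fraction x x :=
  Fraction (id1 x) (J_id x).

Definition comp_fraction (x y z : ob S) (q : fraction y z) (p : fraction x y) :
  fraction x z :=
  Fraction (fwd q ∘ pr2 (link p q))
    (J_comp (J_back p) (J_pr1 (fwd p) (J_back q))).

Definition fraction_graph : two_graph := {|
  ob := ob S;
  hom := fraction;
  cell := fraction_map;
  id1 := id_fraction;
  comp := comp_fraction
|}.

Definition is_identity_map (x y : ob S) (p : fraction x y)
  (t : fraction_map p p) : Prop :=
  exists l : pr1 (meet p p) ⇒ pr2 (meet p p),
    is_canonical_lift (back p) l /\ t = fwd p ◁ l.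

(* u1 ×_x u2 ×_x u3 is taken to be (u1 ×_x u2) ×_x u3. *)
Definition is_vertical_composite (x y : ob S) (p1 p2 p3 : fraction x y)
  (t1 : fraction_map p1 p2) (t2 : fraction_map p2 p3)
  (t : fraction_map p1 p3) : Prop :=
  let T := pb (back p1 ∘ pr1 (meet p1 p2)) (J_back p3) in
  let pr12 := pr1 T in
  exists (pr13 : hom (apex T) (apex (meet p1 p3)))
         (pr23 : hom (apex T) (apex (meet p2 p3)))
         (e : (fwd p2 ∘ pr2 (meet p1 p2)) ∘ pr12 =
              (fwd p2 ∘ pr1 (meet p2 p3)) ∘ pr23),
    (pr1 (meet p1 p3) ∘ pr13 = pr1 (meet p1 p2) ∘ pr12 /\
     pr2 (meet p1 p3) ∘ pr13 = pr2 T) /\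
    (pr1 (meet p2 p3) ∘ pr23 = pr2 (meet p1 p2) ∘ pr12 /\
     pr2 (meet p2 p3) ∘ pr23 = pr2 T) /\
    unique (fun t' : fraction_map p1 p3 =>
      t' ▷ pr13 ~= vcomp_along e (t1 ▷ pr12) (t2 ▷ pr23)) t.

(* Left and right refer to the diagrammatic order of spans: right whiskering by
   r is 1_r ∘ t, left whiskering by p is a ∘ 1_p. *)
Definition is_right_whiskering (x y z : ob S) (p q : fraction x y)
  (t : fraction_map p q) (r : fraction y z)
  (s : fraction_map (comp_fraction r p) (comp_fraction r q)) : Prop :=
  let P := meet (comp_fraction r p) (comp_fraction r q) in
  exists (m : hom (apex P) (apex (meet p q)))
         (rho : pr2 (link p r) ∘ pr1 P ⇒ pr2 (link q r) ∘ pr2 P),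
    (pr1 (meet p q) ∘ m = pr1 (link p r) ∘ pr1 P /\
     pr2 (meet p q) ∘ m = pr1 (link q r) ∘ pr2 P) /\
    unique (fun rho' => back r ◁ rho' ~= t ▷ m) rho /\
    s ~= fwd r ◁ rho.

(* The composites of q with (id_u, f) and of q with (j, id_u); see
   [restrictE] and [pushE]. *)
Definition restrict (u y z : ob S) (f : hom u y) (q : fraction y z) :
  fraction u z :=
  Fraction (fwd q ∘ pr2 (pb f (J_back q))) (J_pr1 f (J_back q)).

Definition push (u x z : ob S) (j : hom u x) (Jj : J j) (q : fraction u z) :
  fraction x z :=
  Fraction (fwd q) (J_comp Jj (J_back q)).

Lemma fraction_eq (x y v : ob S) (k k' : hom v x) (g g' : hom v y)
  (Jk : J k) (Jk' : J k') :
  k = k' -> g = g' -> Fraction g Jk = Fraction g' Jk'.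
Proof.
intros <- <-; now rewrite (proof_irrelevance _ Jk Jk').
Qed.

Lemma restrictE (u y z : ob S) (f : hom u y) (q : fraction y z) :
  comp_fraction q (Fraction f (J_id u)) = restrict f q.
Proof. apply fraction_eq; [apply comp_id_l | reflexivity]. Qed.

Lemma pushE (u x z : ob S) (j : hom u x) (Jj : J j) (q : fraction u z) :
  comp_fraction q (Fraction (id1 u) Jj) = push Jj q.
Proof.
unfold comp_fraction, link, push; simpl.
generalize (J_comp Jj (J_pr1 (id1 u) (J_back q))).
rewrite (pb_id_l (J_back q)); simpl; intros H.
apply fraction_eq; [reflexivity | apply comp_id_r].
Qed.

(* Case I: left whiskering by (id_u, f). *)
Definition is_restriction (u y z : ob S) (f : hom u y) (q1 q2 : fraction y z)
  (a : fraction_map q1 q2)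
  (b : fraction_map (restrict f q1) (restrict f q2)) : Prop :=
  let P := meet (restrict f q1) (restrict f q2) in
  exists m : hom (apex P) (apex (meet q1 q2)),
    (pr1 (meet q1 q2) ∘ m = pr2 (pb f (J_back q1)) ∘ pr1 P /\
     pr2 (meet q1 q2) ∘ m = pr2 (pb f (J_back q2)) ∘ pr2 P) /\
    b ~= a ▷ m.

(* Case II: left whiskering by (j, id_u).  Here [v12] and [V12] are the spans
   with apexes v1 ×_u v2 and v1 ×_x v2, and [W] has apex v12 ×_x V12. *)
Definition is_pushforward (u x z : ob S) (j : hom u x) (Jj : J j)
  (q1 q2 : fraction u z) (a : fraction_map q1 q2)
  (b : fraction_map (push Jj q1) (push Jj q2)) : Prop :=
  let v12 := meet q1 q2 in
  let V12 := meet (push Jj q1) (push Jj q2) in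
  let toX := (j ∘ back q1) ∘ pr1 V12 in
  let J_toX : J toX :=
    J_comp (J_back (push Jj q1)) (J_pr1 (j ∘ back q1) (J_back (push Jj q2))) in
  let W := pb ((j ∘ back q1) ∘ pr1 v12) J_toX in
  exists (c : hom (apex v12) (apex V12))
         (k : pr2 W ⇒ c ∘ pr1 W) (k' : c ∘ pr1 W ⇒ pr2 W)
         (e : (fwd q1 ∘ pr1 V12) ∘ (c ∘ pr1 W) = (fwd q1 ∘ pr1 v12) ∘ pr1 W)
         (e' : (fwd q2 ∘ pr2 v12) ∘ pr1 W = (fwd q2 ∘ pr2 V12) ∘ (c ∘ pr1 W)),
    (pr1 V12 ∘ c = pr1 v12 /\ pr2 V12 ∘ c = pr2 v12) /\
    is_canonical_lift toX k /\ is_canonical_lift toX k' /\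
    unique (fun b' : fraction_map (push Jj q1) (push Jj q2) =>
      b' ▷ pr2 W =
      vcomp_along e'
        (vcomp_along e ((fwd q1 ∘ pr1 V12) ◁ k) (a ▷ pr1 W))
        ((fwd q2 ∘ pr2 V12) ◁ k')) b.

(* [comp_fraction q p] is convertible to
   [push (J_back p) (restrict (fwd p) q)]. *)
Definition is_left_whiskering (x y z : ob S) (p : fraction x y)
  (q1 q2 : fraction y z) (a : fraction_map q1 q2)
  (s : fraction_map (comp_fraction q1 p) (comp_fraction q2 p)) : Prop :=
  exists b : fraction_map (restrict (fwd p) q1) (restrict (fwd p) q2),
    is_restriction a b /\ is_pushforward (Jj := J_back p) b s.

(* The equations on [al] say that it commutes with the projections to
   u, v and w. *)
Definition is_associator (x1 x2 x3 x4 : ob S)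
  (r : fraction x3 x4) (q : fraction x2 x3) (p : fraction x1 x2)
  (s : fraction_map (comp_fraction (comp_fraction r q) p)
                    (comp_fraction r (comp_fraction q p))) : Prop :=
  let F := comp_fraction (comp_fraction r q) p in
  let F' := comp_fraction r (comp_fraction q p) in
  let L := link p (comp_fraction r q) in
  let L' := link (comp_fraction q p) r in
  exists (al : hom (fapex F) (fapex F'))
         (k : al ∘ pr1 (meet F F') ⇒ pr2 (meet F F')),
    (pr1 (link p q) ∘ (pr1 L' ∘ al) = pr1 L /\
     pr2 (link p q) ∘ (pr1 L' ∘ al) = pr1 (link q r) ∘ pr2 L /\
     pr2 L' ∘ al = pr2 (link q r) ∘ pr2 L) /\
    is_canonical_lift (back F') k /\
    s ~= fwd F' ◁ k.

End Fractions.

(* Main.v *)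
From Stdlib Require Import ssreflect ProofIrrelevance IndefiniteDescription.
Require Import Defs.

Set Implicit Arguments.
Unset Strict Implicit.
Unset Printing Implicit Defensive.

Local Open Scope bicat_scope.

(** A map of fractions [t] from (j, f) to (k, g), with apexes u and v, is a single
    2-arrow on the strict pullback u ×_x v; but as the arrows of J are ff and
    co-ff it has a value at any 2-arrow [s : j ∘ a ⇒ k ∘ b] between generalized
    elements [a : w -> u] and [b : w -> v].  Indeed, pulling back along k gives
    a [n : w' -> w] in J and a [b' : w' -> v] with j a n = k b'; there t
    provides f a n ⇒ g b', the lift of [s ▷ n] through k is a 2-arrow
    b' ⇒ b n, and the composite f a n ⇒ g b' ⇒ g b n descends along n to a
    2-arrow [ev t s : f ∘ a ⇒ g ∘ b].  Maps of fractions are thus the same thing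
    as families of values that are natural in w, a and b ([ev_natural],
    [ev_inj]), and such a family may be prescribed locally, on a cover of
    each argument ([map_of_local]).

    In terms of values the structure has no pullbacks left in it.  Writing l for
    a lift through a backward leg:
    - the identity of (j, f) sends j ◁ l to f ◁ l;
    - [ev (t1 • t2) (s1 • s2) = ev t1 s1 • ev t2 s2];
    - the value at s of (k, h) ◁ t is h ◁ l, where k ◁ l is the value of t at s;
    - the value at j ◁ l of t ▷ (j, f) is the value of t at f ◁ l.
    Each law of a bicategory is checked by comparing values; interchange, for
    instance, holds because both of its sides send s to the value of the
    second map at the value of the first map at s ([interchange_map]).

    Unitors and associators come from 1-arrows c between the apexes that commute
    with both legs: such a c induces a map sending k ◁ l, for l : c a ⇒ b, to
    g ◁ l ([induced]).  Induced maps are invertible, are closed under vertical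
    composition and whiskering, and are determined by c.  The triangle and
    the pentagon therefore follow from equations between 1-arrows into iterated
    pullbacks, which are checked on projections.

    Finally the 2-arrows so obtained satisfy the explicit formulas for the
    structure, because a map is recovered from its values at identities
    ([ev_projections], [ev_at]), and because a 2-arrow on a meet of fractions is
    determined by its whiskering with any 1-arrow whose composite to x
    is in J ([whisk_faithful]). *)

(** * 2-arrows with varying source and target *)

Section TotalCells.
Variable K : two_category.

(** In a strict 2-category the equations between 1-arrows are propositional, so
    that equal whiskered 2-arrows may live in different types.  Equality in
    [total x y] is Leibniz equality up to such transports: whiskering becomes a
    strict action on [total], by which one can rewrite. *)
Definition total (x y : ob K) : Type :=
  {f : hom x y & {g : hom x y & f ⇒ g}}.

Definition tot (x y : ob K) (f g : hom x y) (a : f ⇒ g) : total x y :=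
  existT _ f (existT _ g a).

Definition total_id (x y : ob K) (f : hom x y) : total x y := tot (id2 f).

Definition total_lw (x y z : ob K) (f : hom y z) (c : total x y) : total x z :=
  tot (f ◁ projT2 (projT2 c)).

Definition total_rw (x y z : ob K) (c : total y z) (f : hom x y) : total x z :=
  tot (projT2 (projT2 c) ▷ f).

(** The sources and targets being equal, uniqueness of identity proofs removes
    the transport. *)
Lemma tot_inj (x y : ob K) (f g : hom x y) (a b : f ⇒ g) :
  tot a = tot b -> a = b.
Proof. by move=> h; do 2 apply inj_pair2 in h. Qed.

Lemma tot_dom (x y : ob K) (f g f' g' : hom x y) (a : f ⇒ g) (b : f' ⇒ g') :
  tot a = tot b -> f = f'.
Proof. by move=> h; exact (f_equal (@projT1 _ _) h). Qed.

Lemma tot_cod (x y : ob K) (f g f' g' : hom x y) (a : f ⇒ g) (b : f' ⇒ g') :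
  tot a = tot b -> g = g'.
Proof. by move=> h; exact (f_equal (fun c => projT1 (projT2 c)) h). Qed.

Lemma tot_id (x y : ob K) (f : hom x y) : tot (id2 f) = total_id f.
Proof. by []. Qed.

Lemma tot_lw (x y z : ob K) (f : hom y z) (g h : hom x y) (a : g ⇒ h) :
  tot (f ◁ a) = total_lw f (tot a).
Proof. by []. Qed.

Lemma tot_rw (x y z : ob K) (g h : hom y z) (a : g ⇒ h) (f : hom x y) :
  tot (a ▷ f) = total_rw (tot a) f.
Proof. by []. Qed.

Lemma tot_vcomp (x y : ob K) (f g h f' g' h' : hom x y)
  (a : f ⇒ g) (b : g ⇒ h) (a' : f' ⇒ g') (b' : g' ⇒ h') :
  tot a = tot a' -> tot b = tot b' -> tot (a • b) = tot (a' • b').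
Proof.
move=> ha hb.
move: (tot_dom ha) (tot_cod ha) (tot_cod hb) => ? ? ?; subst.
by rewrite (tot_inj ha) (tot_inj hb).
Qed.

Lemma tot_idcell_r (x y : ob K) (f g g' : hom x y) (e : g = g') (a : f ⇒ g) :
  tot (a • idcell e) = tot a.
Proof. case: g' / e => /=; by rewrite (vcomp_id_r (two_laws K)). Qed.

Lemma tot_idcell_l (x y : ob K) (f f' g : hom x y) (e : f' = f) (a : f ⇒ g) :
  tot (idcell e • a) = tot a.
Proof. case: f / e a => /= a; by rewrite (vcomp_id_l (two_laws K)). Qed.

Lemma vcomp_idl (x y : ob K) (f g : hom x y) (a : f ⇒ g) : id2 f • a = a.
Proof. exact (vcomp_id_l (two_laws K) a). Qed.

Lemma vcomp_idr (x y : ob K) (f g : hom x y) (a : f ⇒ g) : a • id2 g = a.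
Proof. exact (vcomp_id_r (two_laws K) a). Qed.

Lemma vcompA (x y : ob K) (f g h k : hom x y) (a : f ⇒ g) (b : g ⇒ h)
  (c : h ⇒ k) : a • (b • c) = (a • b) • c.
Proof. exact (vcomp_assoc (two_laws K) a b c). Qed.

Lemma lwhisk_V (x y z : ob K) (f : hom y z) (g h k : hom x y)
  (a : g ⇒ h) (b : h ⇒ k) : f ◁ (a • b) = f ◁ a • f ◁ b.
Proof. exact (lwhisk_vcomp (two_laws K) f a b). Qed.

Lemma rwhisk_V (x y z : ob K) (g h k : hom y z) (a : g ⇒ h) (b : h ⇒ k)
  (f : hom x y) : (a • b) ▷ f = a ▷ f • b ▷ f.
Proof. exact (rwhisk_vcomp (two_laws K) a b f). Qed.

Lemma tot_absorb_l (x y : ob K) (f g h f' : hom x y) (a : f ⇒ g) (b : g ⇒ h) :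
  tot a = total_id f' -> tot (a • b) = tot b.
Proof.
move=> ha; move: (tot_dom ha) (tot_cod ha) => ? ?; subst.
by rewrite (tot_inj ha) vcomp_idl.
Qed.

Lemma tot_absorb_r (x y : ob K) (f g h f' : hom x y) (a : f ⇒ g) (b : g ⇒ h) :
  tot b = total_id f' -> tot (a • b) = tot a.
Proof.
move=> ha; move: (tot_dom ha) (tot_cod ha) => ? ?; subst.
by rewrite (tot_inj ha) vcomp_idr.
Qed.

Lemma total_lw_id (x y z : ob K) (f : hom y z) (g : hom x y) :
  total_lw f (total_id g) = total_id (f ∘ g).
Proof. by rewrite -(tot_id g) -tot_lw (lwhisk_id (two_laws K)). Qed.

Lemma total_rw_id (x y z : ob K) (g : hom y z) (f : hom x y) :
  total_rw (total_id g) f = total_id (g ∘ f).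
Proof. by rewrite -(tot_id g) -tot_rw (rwhisk_id (two_laws K)). Qed.

Lemma total_lw_comp (w x y z : ob K) (h : hom y z) (g : hom x y) (c : total w x) :
  total_lw (h ∘ g) c = total_lw h (total_lw g c).
Proof.
case: c => f [f' a]; change (tot ((h ∘ g) ◁ a) = tot (h ◁ (g ◁ a))).
rewrite -(tot_idcell_r (comp_assoc h g f')) -associator_strict.
by rewrite (associator_natural_r (two_laws K)) associator_strict tot_idcell_l.
Qed.

Lemma total_rw_comp (w x y z : ob K) (c : total y z) (g : hom x y) (f : hom w x) :
  total_rw c (g ∘ f) = total_rw (total_rw c g) f.
Proof.
case: c => h [h' a]; change (tot (a ▷ (g ∘ f)) = tot ((a ▷ g) ▷ f)).
rewrite -(tot_idcell_r (comp_assoc h' g f)) -associator_strict.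
by rewrite (associator_natural_l (two_laws K)) associator_strict tot_idcell_l.
Qed.

Lemma total_lw_rw (w x y z : ob K) (h : hom y z) (c : total x y) (f : hom w x) :
  total_rw (total_lw h c) f = total_lw h (total_rw c f).
Proof.
case: c => g [g' a]; change (tot ((h ◁ a) ▷ f) = tot (h ◁ (a ▷ f))).
rewrite -(tot_idcell_r (comp_assoc h g' f)) -associator_strict.
by rewrite (associator_natural_m (two_laws K)) associator_strict tot_idcell_l.
Qed.

Lemma total_lw_id1 (x y : ob K) (c : total x y) : total_lw (id1 y) c = c.
Proof.
case: c => f [f' a]; change (tot (id1 y ◁ a) = tot a).
rewrite -(tot_idcell_r (comp_id_l f')) -lunitor_strict.
by rewrite (lunitor_natural (two_laws K)) lunitor_strict tot_idcell_l.
Qed.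

Lemma total_rw_id1 (x y : ob K) (c : total x y) : total_rw c (id1 x) = c.
Proof.
case: c => f [f' a]; change (tot (a ▷ id1 x) = tot a).
rewrite -(tot_idcell_r (comp_id_r f')) -runitor_strict.
by rewrite (runitor_natural (two_laws K)) runitor_strict tot_idcell_l.
Qed.

Lemma cell_eq_tot (x y : ob K) (f g f' g' : hom x y) (a : f ⇒ g)
  (b : f' ⇒ g') : a ~= b <-> tot a = tot b.
Proof.
split; first by case.
move=> h; move: (tot_dom h) (tot_cod h) => ? ?; subst.
by rewrite (tot_inj h).
Qed.

(** Stating transport as an existence result keeps casts out of the terms: all
    that is ever used of the transported 2-arrow is its class under [tot]. *)
Lemma cast_ex (x y : ob K) (f g f' g' : hom x y) (a : f ⇒ g) :
  f = f' -> g = g' -> exists a' : f' ⇒ g', tot a' = tot a.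
Proof. by move=> <- <-; exists a. Qed.

Lemma idcell_ex (x y : ob K) (f g : hom x y) :
  f = g -> exists a : f ⇒ g, tot a = total_id f.
Proof. by move=> <-; exists (id2 f). Qed.

End TotalCells.

(** Normal form of iterated whiskerings: left factors one by one outside, right
    factors one by one inside. *)
Ltac whiskers := rewrite ?(tot_lw, tot_rw, total_lw_comp, total_rw_comp,
  total_lw_rw, tot_id, total_lw_id, total_rw_id, total_lw_id1, total_rw_id1).

(** * Lifting and descent in a 2-site *)

Section Site.
Variable S : two_site.

Lemma lift_ex (x y w : ob S) (j : hom x y) (Jj : J j) (a b : hom w x)
  (f g : hom w y) (s : f ⇒ g) :
  f = j ∘ a -> g = j ∘ b -> exists l : a ⇒ b, tot (j ◁ l) = tot s.
Proof.
by move=> ? ?; subst; case: (J_ff Jj s) => l [h _]; exists l; rewrite -h.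
Qed.

Lemma lift_inj (x y w : ob S) (j : hom x y) (Jj : J j) (a b a' b' : hom w x)
  (l : a ⇒ b) (l' : a' ⇒ b') :
  a = a' -> b = b' -> tot (j ◁ l) = tot (j ◁ l') -> tot l = tot l'.
Proof.
move=> ? ? /[dup] h; subst => /tot_inj {}h.
case: (J_ff Jj (j ◁ l)) => m [_ u].
by rewrite -(u l) // -(u l').
Qed.

Lemma descent_ex (x y w : ob S) (n : hom w x) (Jn : J n) (g h : hom x y)
  (f f' : hom w y) (s : f ⇒ f') :
  f = g ∘ n -> f' = h ∘ n -> exists l : g ⇒ h, tot (l ▷ n) = tot s.
Proof.
by move=> ? ?; subst; case: (J_coff Jn s) => l [e _]; exists l; rewrite -e.
Qed.

Lemma descent_inj (x y w : ob S) (n : hom w x) (Jn : J n) (g h g' h' : hom x y)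
  (s : g ⇒ h) (s' : g' ⇒ h') :
  g = g' -> h = h' -> tot (s ▷ n) = tot (s' ▷ n) -> tot s = tot s'.
Proof.
move=> ? ? ; subst=> /tot_inj e; case: (J_coff Jn (s ▷ n)) => m [_ u].
by rewrite -(u s) // -(u s').
Qed.

Section Pullback.
Variables (x y u : ob S) (f : hom x y) (j : hom u y) (Jj : J j).

Lemma square : f ∘ pr1 (pb f Jj) = j ∘ pr2 (pb f Jj).
Proof. by case: (pb_pullback f Jj). Qed.

Lemma total_square (w : ob S) (c : total w (apex (pb f Jj))) :
  total_lw f (total_lw (pr1 (pb f Jj)) c) =
  total_lw j (total_lw (pr2 (pb f Jj)) c).
Proof. by rewrite -!total_lw_comp square. Qed.

Lemma pair_ex (w : ob S) (a : hom w x) (b : hom w u) :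
  f ∘ a = j ∘ b ->
  exists h, pr1 (pb f Jj) ∘ h = a /\ pr2 (pb f Jj) ∘ h = b.
Proof.
by move=> e; case: (pb_pullback f Jj) => _ [/(_ _ _ _ e) [h [? _]] _]; exists h.
Qed.

Lemma pair_eq (w : ob S) (h h' : hom w (apex (pb f Jj))) :
  pr1 (pb f Jj) ∘ h = pr1 (pb f Jj) ∘ h' ->
  pr2 (pb f Jj) ∘ h = pr2 (pb f Jj) ∘ h' -> h = h'.
Proof.
move=> e1 e2; case: (pb_pullback f Jj) => sq [U _].
have e : f ∘ (pr1 (pb f Jj) ∘ h') = j ∘ (pr2 (pb f Jj) ∘ h').
  by rewrite -!comp_assoc sq.
case: (U _ _ _ e) => m [_ V].
by rewrite -(V h) // -(V h').
Qed.

(** Being a strict pullback square is symmetric in the two projections. *)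
Lemma J_pr2 : J f -> J (pr2 (pb f Jj)).
Proof.
move=> Jf; apply: (J_pullback (f := j) (q := pr1 (pb f Jj)) _ Jf).
case: (pb_pullback f Jj) => sq [U V]; split; [|split].
- by rewrite sq.
- move=> w a b e; case: (U w b a (eq_sym e)) => h [[h1 h2] U'].
  by exists h; split=> // h' [? ?]; apply: U'.
- move=> w h k s t /cell_eq_tot e.
  have e' : f ◁ t ~= j ◁ s by apply/cell_eq_tot.
  case: (V w h k t s e') => r [[h1 h2] U'].
  by exists r; split=> // h' [? ?]; apply: U'.
Qed.

End Pullback.

(** An element of x lifts through an arrow of J after restriction along an arrow
    of J, along which 2-arrows descend; in this sense the lift exists locally. *)
Lemma cover (x u w : ob S) (j : hom u x) (a : hom w x) (Jj : J j) :
  exists (w' : ob S) (n : hom w' w) (b : hom w' u), J n /\ a ∘ n = j ∘ b.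
Proof.
exists (apex (pb a Jj)), (pr1 (pb a Jj)), (pr2 (pb a Jj)); split.
  exact: J_pr1.
exact: square.
Qed.

End Site.

(** * Maps of fractions as natural families *)

Ltac arrows := rewrite ?comp_assoc ?comp_id_l ?comp_id_r //.
Ltac cast := apply: cast_ex; arrows.

Section Evaluation.
Variable S : two_site.

Lemma restrict_ex (w' w u v x : ob S) (f : hom u x) (g : hom v x) (a : hom w u)
  (b : hom w v) (s : f ∘ a ⇒ g ∘ b) (m : hom w' w) :
  exists s' : f ∘ (a ∘ m) ⇒ g ∘ (b ∘ m), tot s' = tot (s ▷ m).
Proof. cast. Qed.

(** [a] and [b] are generalized elements of the two apexes at a stage [w]. *)
Definition family (x y : ob S) (p q : fraction x y) : Type :=
  forall (w : ob S) (a : hom w (fapex p)) (b : hom w (fapex q)),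
    back p ∘ a ⇒ back q ∘ b -> fwd p ∘ a ⇒ fwd q ∘ b.

Definition value_relation (x y : ob S) (p q : fraction x y) : Type :=
  forall (w : ob S) (a : hom w (fapex p)) (b : hom w (fapex q)),
    back p ∘ a ⇒ back q ∘ b -> fwd p ∘ a ⇒ fwd q ∘ b -> Prop.

Record is_natural (x y : ob S) (p q : fraction x y) (T : family p q) : Prop := {
  nat_whisk : forall (w w' : ob S) (m : hom w' w) (a : hom w (fapex p))
    (b : hom w (fapex q)) (s : back p ∘ a ⇒ back q ∘ b)
    (s' : back p ∘ (a ∘ m) ⇒ back q ∘ (b ∘ m)),
    tot s' = tot (s ▷ m) ->
    tot (T w' (a ∘ m) (b ∘ m) s') = tot (T w a b s ▷ m);
  nat_cell : forall (w : ob S) (a a' : hom w (fapex p)) (b b' : hom w (fapex q))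
    (f : a' ⇒ a) (s : back p ∘ a ⇒ back q ∘ b) (g : b ⇒ b'),
    T w a' b' (back p ◁ f • s • back q ◁ g) =
    fwd p ◁ f • T w a b s • fwd q ◁ g
}.

(** A relation that prescribes the values of a natural family on enough
    arguments: [loc_ex] says that every argument is covered by one on which a
    value is prescribed, and [loc_cell] that the prescribed values obey
    naturality wherever both sides are prescribed; for identities this says
    that a prescribed value is unique. *)
Record is_local (x y : ob S) (p q : fraction x y) (R : value_relation p q) :
  Prop := {
  loc_whisk : forall (w w' : ob S) (m : hom w' w) (a : hom w (fapex p))
    (b : hom w (fapex q)) (s : back p ∘ a ⇒ back q ∘ b)
    (r : fwd p ∘ a ⇒ fwd q ∘ b)
    (s' : back p ∘ (a ∘ m) ⇒ back q ∘ (b ∘ m))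
    (r' : fwd p ∘ (a ∘ m) ⇒ fwd q ∘ (b ∘ m)),
    R w a b s r -> tot s' = tot (s ▷ m) -> tot r' = tot (r ▷ m) ->
    R w' (a ∘ m) (b ∘ m) s' r';
  loc_cell : forall (w : ob S) (a a' : hom w (fapex p)) (b b' : hom w (fapex q))
    (f : a' ⇒ a) (s : back p ∘ a ⇒ back q ∘ b) (g : b ⇒ b')
    (r : fwd p ∘ a ⇒ fwd q ∘ b) (r' : fwd p ∘ a' ⇒ fwd q ∘ b'),
    R w a b s r -> R w a' b' (back p ◁ f • s • back q ◁ g) r' ->
    r' = fwd p ◁ f • r • fwd q ◁ g;
  loc_ex : forall (w : ob S) (a : hom w (fapex p)) (b : hom w (fapex q))
    (s : back p ∘ a ⇒ back q ∘ b),
    exists (w' : ob S) (n : hom w' w)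
      (s' : back p ∘ (a ∘ n) ⇒ back q ∘ (b ∘ n))
      (r' : fwd p ∘ (a ∘ n) ⇒ fwd q ∘ (b ∘ n)),
      J n /\ tot s' = tot (s ▷ n) /\ R w' (a ∘ n) (b ∘ n) s' r'
}.

Section Glue.
Variables (x y : ob S) (p q : fraction x y) (R : value_relation p q).
Hypothesis L : is_local R.

Lemma local_unique (w : ob S) (a a' : hom w (fapex p)) (b b' : hom w (fapex q))
  (s : back p ∘ a ⇒ back q ∘ b) (s' : back p ∘ a' ⇒ back q ∘ b')
  (r : fwd p ∘ a ⇒ fwd q ∘ b) (r' : fwd p ∘ a' ⇒ fwd q ∘ b') :
  a = a' -> b = b' -> tot s = tot s' ->
  R s r -> R s' r' -> tot r = tot r'.
Proof.
move=> ? ? ; subst=> /tot_inj -> h h'.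
have e : s' = back p ◁ id2 a' • s' • back q ◁ id2 b'.
  by rewrite !(lwhisk_id (two_laws S)) vcomp_idl vcomp_idr.
rewrite e in h'.
by rewrite (loc_cell L h h') !(lwhisk_id (two_laws S)) vcomp_idl vcomp_idr.
Qed.

Let value (w : ob S) (a : hom w (fapex p)) (b : hom w (fapex q))
  (s : back p ∘ a ⇒ back q ∘ b) (r : fwd p ∘ a ⇒ fwd q ∘ b) : Prop :=
  forall (w' : ob S) (m : hom w' w) (s' : back p ∘ (a ∘ m) ⇒ back q ∘ (b ∘ m))
    (r' : fwd p ∘ (a ∘ m) ⇒ fwd q ∘ (b ∘ m)),
    tot s' = tot (s ▷ m) -> R s' r' -> tot r' = tot (r ▷ m).

(** The value at [s] is the descent of a value prescribed on one cover.  To see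
    that it agrees with those prescribed on any other restriction [m], compare
    the two on a common refinement of [m] and the cover. *)
Lemma value_ex (w : ob S) (a : hom w (fapex p)) (b : hom w (fapex q))
  (s : back p ∘ a ⇒ back q ∘ b) : exists r, value s r.
Proof.
have [w1 [n [s1 [r1 [Jn [e1 R1]]]]]] := loc_ex L s.
have [r er] := descent_ex (g := fwd p ∘ a) (h := fwd q ∘ b) Jn r1
  (eq_sym (comp_assoc _ _ _)) (eq_sym (comp_assoc _ _ _)).
exists r => w2 m s2 r2 e2 R2.
have [w3 [n3 [m3 [Jn3 e3]]]] := cover m Jn.
apply: (descent_inj Jn3); arrows.
have E1 : forall c, total_rw (total_rw c m) n3 = total_rw (total_rw c n) m3.
  by move=> X Y; rewrite -!total_rw_comp e3.
have [s2' es2'] := restrict_ex s2 n3.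
have [r2' er2'] := restrict_ex r2 n3.
have [s1' es1'] := restrict_ex s1 m3.
have [r1' er1'] := restrict_ex r1 m3.
rewrite (tot_rw (r ▷ m)) (tot_rw r m) E1 -(tot_rw r) er -tot_rw -er2' -er1'.
apply: (local_unique (s := s2') (s' := s1')).
- by rewrite !comp_assoc e3.
- by rewrite !comp_assoc e3.
- by rewrite es2' es1' !tot_rw e2 e1 !tot_rw E1.
- exact: (loc_whisk L R2).
- exact: (loc_whisk L R1).
Qed.

Lemma value_unique (w : ob S) (a : hom w (fapex p)) (b : hom w (fapex q))
  (s : back p ∘ a ⇒ back q ∘ b) (r r' : fwd p ∘ a ⇒ fwd q ∘ b) :
  value s r -> value s r' -> r = r'.
Proof.
move=> h h'; have [w1 [n [s1 [r1 [Jn [e1 R1]]]]]] := loc_ex L s.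
apply/tot_inj/(descent_inj Jn) => //.
by rewrite -(h _ _ _ _ e1 R1) -(h' _ _ _ _ e1 R1).
Qed.

Lemma value_spec (w : ob S) (a : hom w (fapex p)) (b : hom w (fapex q))
  (s : back p ∘ a ⇒ back q ∘ b) (r r' : fwd p ∘ a ⇒ fwd q ∘ b) :
  R s r -> value s r' -> r = r'.
Proof.
move=> h h'.
have [s1 es1] := restrict_ex s (id1 w).
have [r1 er1] := restrict_ex r (id1 w).
apply: tot_inj; rewrite -(total_rw_id1 (tot r)) -tot_rw -er1.
by rewrite (h' _ (id1 w) s1 r1 es1 (loc_whisk L h es1 er1)) tot_rw total_rw_id1.
Qed.

(** Naturality in [a] and [b] holds on a common refinement of the covers on which
    the two values are prescribed, hence everywhere. *)
Lemma glue : exists T : family p q, is_natural T /\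
  forall w a b (s : back p ∘ a ⇒ back q ∘ b) r, R s r -> T w a b s = r.
Proof.
pose T w a b s := proj1_sig (constructive_indefinite_description _
  (@value_ex w a b s)).
have hT w a b s : value s (T w a b s).
  by rewrite /T; case: constructive_indefinite_description.
have hT' w w' (n : hom w' w) a b a' b' (s : back p ∘ a ⇒ back q ∘ b)
      (s' : back p ∘ a' ⇒ back q ∘ b') (r' : fwd p ∘ a' ⇒ fwd q ∘ b') :
    a' = a ∘ n -> b' = b ∘ n -> tot s' = tot (s ▷ n) ->
    R s' r' -> tot r' = tot (T w a b s ▷ n).
  by move=> ? ?; subst; apply: hT.
exists T; split; last first.
  by move=> w a b s r h; rewrite (value_spec h (hT _ _ _ _)).
split.
- move=> w w' m a b s s' es.
  have [r er] := restrict_ex (T w a b s) m.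
  rewrite -er; congr tot; apply: value_unique; first exact: hT.
  move=> w2 n s2 r2 es2 h2; rewrite tot_rw er tot_rw -total_rw_comp.
  apply: (hT' _ _ (m ∘ n) a b _ _ s s2 r2 _ _ _ h2); arrows.
  by rewrite es2 tot_rw es; whiskers.
- move=> w a a' b b' f s g.
  have [w1 [n1 [s1 [r1 [J1 [e1 R1]]]]]] := loc_ex L s.
  have [s' es'] := restrict_ex (back p ◁ f • s • back q ◁ g) n1.
  have [w2 [n2 [s2 [r2 [J2 [e2 R2]]]]]] := loc_ex L s'.
  have [s3 es3] := restrict_ex s1 n2.
  have [r3 er3] := restrict_ex r1 n2.
  have R3 := loc_whisk L R1 es3 er3.
  have es2 : s2 =
      back p ◁ ((f ▷ n1) ▷ n2) • s3 • back q ◁ ((g ▷ n1) ▷ n2).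
    apply: tot_inj; rewrite e2 tot_rw es' -tot_rw !rwhisk_V.
    apply: tot_vcomp; [apply: tot_vcomp |]; whiskers => //.
    by rewrite es3 tot_rw e1; whiskers.
  have e2' : tot s2 = tot ((back p ◁ f • s • back q ◁ g) ▷ (n1 ∘ n2)).
    by rewrite e2 tot_rw es'; whiskers.
  have v2 := hT' _ _ (n1 ∘ n2) a' b' _ _ (back p ◁ f • s • back q ◁ g) s2 r2
    (comp_assoc _ _ _) (comp_assoc _ _ _) e2' R2.
  have v3 := hT' _ _ n1 a b _ _ s s1 r1 eq_refl eq_refl e1 R1.
  rewrite es2 in R2; have er2 := loc_cell L R3 R2.
  apply/tot_inj/(descent_inj (J_comp J1 J2)) => //.
  rewrite -v2 er2 2!rwhisk_V.
  apply: tot_vcomp; [apply: tot_vcomp |]; whiskers => //.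
  by rewrite er3 tot_rw v3; whiskers.
Qed.

End Glue.

Section MapFamily.
Variables (x y : ob S) (p q : fraction x y).

(** Values that can be read off from [t] by whiskering alone: those at the
    2-arrows [back q ◁ g] out of an element [c] of the pullback. *)
Definition map_rel (t : fraction_map p q) : value_relation p q :=
  fun w a b s r => exists (c : hom w (apex (meet p q)))
    (g : pr2 (meet p q) ∘ c ⇒ b),
    pr1 (meet p q) ∘ c = a /\ tot s = tot (back q ◁ g) /\
    exists t' : fwd p ∘ a ⇒ fwd q ∘ (pr2 (meet p q) ∘ c),
      tot t' = tot (t ▷ c) /\ r = t' • fwd q ◁ g.

Lemma meet_square : back p ∘ pr1 (meet p q) = back q ∘ pr2 (meet p q).
Proof. exact: square. Qed.

Lemma J_meet : J (back p ∘ pr1 (meet p q)).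
Proof. apply: J_comp; [exact: J_back | exact: J_pr1]. Qed.

(** For [loc_cell], a 2-arrow [f : a' ⇒ a] lifts to a 2-arrow [d] between
    elements of the pullback, because its projection to the base is in J; then
    the interchange law for [d] and [t] is the required equation. *)
Lemma map_rel_local t : is_local (map_rel t).
Proof.
split.
- move=> w w' m a b s r s' r' [c [g [ea [es [t' [et' er]]]]]] es' er'.
  have [g1 eg1] : exists z : pr2 (meet p q) ∘ (c ∘ m) ⇒ b ∘ m,
    tot z = tot (g ▷ m) by cast.
  have [t1 et1] : exists z : fwd p ∘ (a ∘ m) ⇒
    fwd q ∘ (pr2 (meet p q) ∘ (c ∘ m)), tot z = tot (t' ▷ m) by cast.
  exists (c ∘ m), g1; split; [|split]; first by rewrite -comp_assoc ea.
    by rewrite es' tot_rw es !tot_lw eg1; whiskers.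
  exists t1; split; first by rewrite et1 tot_rw et'; whiskers.
  apply: tot_inj; rewrite er' er rwhisk_V; apply: tot_vcomp => //.
  by rewrite !(tot_rw, tot_lw) eg1; whiskers.
- move=> w a a' b b' f s g r r' [c [h [ea [es [t' [et' er]]]]]].
  move=> [c' [h' [ea' [es' [u' [eu' er']]]]]].
  have [d ed] : exists d : c' ⇒ c, tot ((back p ∘ pr1 (meet p q)) ◁ d) =
      tot (back p ◁ f).
    by apply: (lift_ex J_meet); rewrite -?ea -?ea'; arrows.
  have e1 : tot (pr1 (meet p q) ◁ d) = tot f.
    by apply: (lift_inj (J_back p)) => //; rewrite -ed; whiskers.
  have e2 : tot h' = tot (pr2 (meet p q) ◁ d • (h • g)).
    apply: (lift_inj (J_back q)) => //.
    rewrite -es' !lwhisk_V vcompA; apply: tot_vcomp; [apply: tot_vcomp |] => //.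
    by rewrite -ed meet_square; whiskers.
  have e3 : tot (u' • fwd q ◁ (pr2 (meet p q) ◁ d)) = tot (fwd p ◁ f • t').
    transitivity (tot (t ▷ c' • (fwd q ∘ pr2 (meet p q)) ◁ d)).
      by apply: tot_vcomp => //; whiskers.
    rewrite -(interchange (two_laws S)); apply: tot_vcomp => //.
    by rewrite tot_lw total_lw_comp -tot_lw e1.
  apply: tot_inj; rewrite er' er (tot_inj e2) !lwhisk_V !vcompA.
  by do 2 (apply: tot_vcomp => //).
- move=> w a b s.
  have [w' [n [b' [Jn e]]]] := cover (back p ∘ a) (J_back q).
  have [c [ec1 ec2]] := pair_ex (f := back p) (a := a ∘ n) (b := b')
    (J_back q) ltac:(by rewrite -comp_assoc).
  have [s' es'] := restrict_ex s n.
  have [g eg] : exists g : pr2 (meet p q) ∘ c ⇒ b ∘ n,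
      tot (back q ◁ g) = tot s'.
    by apply: (lift_ex (J_back q)); rewrite ?ec2 -?e; arrows.
  have [t' et'] : exists z : fwd p ∘ (a ∘ n) ⇒ fwd q ∘ (pr2 (meet p q) ∘ c),
      tot z = tot (t ▷ c) by apply: cast_ex; rewrite -?ec1; arrows.
  exists w', n, s', (t' • fwd q ◁ g); do 2 split=> //.
  by exists c, g; do 2 split=> //; exists t'.
Qed.

Definition ev (t : fraction_map p q) : family p q :=
  proj1_sig (constructive_indefinite_description _ (glue (map_rel_local t))).

Lemma ev_natural t : is_natural (ev t).
Proof. by rewrite /ev; case: constructive_indefinite_description => T []. Qed.

Lemma ev_unique t w a b (s : back p ∘ a ⇒ back q ∘ b) r :
  map_rel (w := w) t s r -> ev t s = r.
Proof.
rewrite /ev; case: constructive_indefinite_description => T [N h]; exact: h.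
Qed.

Lemma ev_congr t w (a a' : hom w (fapex p)) (b b' : hom w (fapex q))
  (s : back p ∘ a ⇒ back q ∘ b) (s' : back p ∘ a' ⇒ back q ∘ b') :
  a = a' -> b = b' -> tot s = tot s' -> tot (ev t s) = tot (ev t s').
Proof. by move=> ? ? ; subst=> /tot_inj ->. Qed.

Lemma ev_whisk t w w' (m : hom w' w) (a : hom w (fapex p))
  (b : hom w (fapex q)) (a' : hom w' (fapex p)) (b' : hom w' (fapex q))
  (s : back p ∘ a ⇒ back q ∘ b) (s' : back p ∘ a' ⇒ back q ∘ b') :
  a' = a ∘ m -> b' = b ∘ m -> tot s' = tot (s ▷ m) ->
  tot (ev t s') = tot (ev t s ▷ m).
Proof. by move=> ? ?; subst; apply: (nat_whisk (ev_natural t)). Qed.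

Lemma ev_pairing t w (c : hom w (apex (meet p q)))
  (s : back p ∘ (pr1 (meet p q) ∘ c) ⇒ back q ∘ (pr2 (meet p q) ∘ c)) f :
  tot s = total_id f -> tot (ev t s) = tot (t ▷ c).
Proof.
move=> es.
have [t' et'] : exists z : fwd p ∘ (pr1 (meet p q) ∘ c) ⇒
    fwd q ∘ (pr2 (meet p q) ∘ c), tot z = tot (t ▷ c) by cast.
rewrite -et'; congr tot; apply: ev_unique.
exists c, (id2 _); split=> //; split.
  by rewrite es; whiskers; rewrite -(tot_id f) in es; rewrite -(tot_cod es).
exists t'; split=> //; apply: tot_inj.
by rewrite (lwhisk_id (two_laws S)) vcomp_idr.
Qed.

(** A map is its own value at the generic element, which makes it recoverable
    from its family of values. *)
Lemma ev_projections t (s : back p ∘ pr1 (meet p q) ⇒ back q ∘ pr2 (meet p q)) f :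
  tot s = total_id f -> tot (ev t s) = tot t.
Proof.
have [s' es'] := restrict_ex s (id1 _); rewrite tot_rw total_rw_id1 in es'.
rewrite -es' => /(ev_pairing t) e; rewrite tot_rw total_rw_id1 in e; rewrite -e.
by apply: ev_congr; arrows.
Qed.

Lemma ev_inj t t' :
  (forall w a b (s : back p ∘ a ⇒ back q ∘ b), ev t (w := w) s = ev t' s) ->
  t = t'.
Proof.
move=> e; have [s es] := idcell_ex meet_square.
by apply: tot_inj; rewrite -(ev_projections t es) -(ev_projections t' es) e.
Qed.

(** The map is the value of the glued family at the generic element. *)
Lemma map_of_local (R : value_relation p q) : is_local R ->
  exists t, forall w a b (s : back p ∘ a ⇒ back q ∘ b) r,
    R w a b s r -> ev t s = r.
Proof.
move=> /glue [T [[Tw Tc] TR]].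
have [s0 es0] := idcell_ex meet_square.
exists (T _ _ _ s0) => w a b s r /TR <- {R TR r}.
have [w' [n [b' [Jn e]]]] := cover (back p ∘ a) (J_back q).
have [c [ec1 ec2]] := pair_ex (f := back p) (a := a ∘ n) (b := b')
  (J_back q) ltac:(by rewrite -comp_assoc).
have [s' es'] := restrict_ex s n.
have [g eg] : exists g : pr2 (meet p q) ∘ c ⇒ b ∘ n,
    tot (back q ◁ g) = tot s'.
  by apply: (lift_ex (J_back q)); rewrite ?ec2 -?e; arrows.
apply/tot_inj/(descent_inj Jn) => //.
rewrite -(Tw _ _ _ _ _ _ _ es') -(ev_whisk (T _ _ _ s0) _ _ es') //.
have [t' et'] : exists z : fwd p ∘ (a ∘ n) ⇒ fwd q ∘ (pr2 (meet p q) ∘ c),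
    tot z = tot (T _ _ _ s0 ▷ c) by apply: cast_ex; rewrite -?ec1; arrows.
have -> : ev (T _ _ _ s0) s' = t' • fwd q ◁ g.
  apply: ev_unique; exists c, g; do 2 split=> //; by exists t'.
have [s1 es1] := restrict_ex s0 c.
have [f ef] := idcell_ex (eq_sym ec1).
have -> : s' = back p ◁ f • s1 • back q ◁ g.
  apply: tot_inj; rewrite -eg; symmetry.
  apply: (tot_absorb_l (f' := back q ∘ b')).
  rewrite (tot_absorb_l (f' := back p ∘ (a ∘ n))).
    by rewrite tot_lw ef total_lw_id.
  by rewrite es1 tot_rw es0 total_rw_id comp_assoc ec1 -comp_assoc e.
rewrite Tc; apply: tot_vcomp => //.
rewrite (tot_absorb_l (f' := fwd p ∘ (a ∘ n))).
  by rewrite tot_lw ef total_lw_id.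
by rewrite et' (Tw _ _ _ _ _ _ _ es1).
Qed.

End MapFamily.
End Evaluation.

(** * Vertical composition and whiskering *)

Section Operations.
Variable S : two_site.

Lemma ev_l (x y : ob S) (p q : fraction x y) (t : fraction_map p q) w
  (a a' : hom w (fapex p)) b (f : a' ⇒ a) (s : back p ∘ a ⇒ back q ∘ b) :
  ev t (back p ◁ f • s) = fwd p ◁ f • ev t s.
Proof.
have := nat_cell (ev_natural t) f s (@id2 _ (two_ops S) _ _ b).
by rewrite !(lwhisk_id (two_laws S)) !vcomp_idr.
Qed.

Lemma ev_r (x y : ob S) (p q : fraction x y) (t : fraction_map p q) w a
  (b b' : hom w (fapex q)) (s : back p ∘ a ⇒ back q ∘ b) (g : b ⇒ b') :
  ev t (s • back q ◁ g) = ev t s • fwd q ◁ g.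
Proof.
have := nat_cell (ev_natural t) (@id2 _ (two_ops S) _ _ a) s g.
by rewrite !(lwhisk_id (two_laws S)) !vcomp_idl.
Qed.

Section Vertical.
Variables (x y : ob S) (p1 p2 p3 : fraction x y).
Variables (t1 : fraction_map p1 p2) (t2 : fraction_map p2 p3).

(* The middle element [b] is only required to exist over [a] on the nose; with an
   arbitrary [s1] the middle elements of two factorizations of the same 2-arrow
   could not be compared. *)
Let vcomp_rel : value_relation p1 p3 := fun w a c s r =>
  exists b (s1 : back p1 ∘ a ⇒ back p2 ∘ b) (s2 : back p2 ∘ b ⇒ back p3 ∘ c),
    tot s1 = total_id (back p1 ∘ a) /\ s = s1 • s2 /\ r = ev t1 s1 • ev t2 s2.

Lemma vcomp_rel_local : is_local vcomp_rel.
Proof.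
split.
- move=> w w' m a c s r s' r' [b [s1 [s2 [e1 [es er]]]]] es' er'.
  have [s1' es1'] := restrict_ex s1 m; have [s2' es2'] := restrict_ex s2 m.
  exists (b ∘ m), s1', s2'.
  split; first by rewrite es1' tot_rw e1; whiskers; arrows.
  split; apply: tot_inj.
    by rewrite es' es rwhisk_V; apply: tot_vcomp.
  by rewrite er' er rwhisk_V; apply: tot_vcomp; symmetry; apply: ev_whisk.
- move=> w a a' c c' f s g r r' [b [s1 [s2 [e1 [-> ->]]]]].
  move=> [b' [s1' [s2' [e1' [es ->]]]]].
  have [d ed] : exists d : b' ⇒ b, tot (back p2 ◁ d) = tot (back p1 ◁ f).
    apply: (lift_ex (J_back p2)); first exact: (eq_sym (tot_cod e1')).
    exact: (eq_sym (tot_cod e1)).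
  have E2 : s2' = back p2 ◁ d • s2 • back p3 ◁ g.
    apply: tot_inj; rewrite -(tot_absorb_l s2' e1') -es !vcompA.
    by do 2 (apply: tot_vcomp => //); rewrite (tot_absorb_r _ e1).
  have E1 : s1' • back p2 ◁ d = back p1 ◁ f • s1.
    by apply: tot_inj; rewrite (tot_absorb_l _ e1') (tot_absorb_r _ e1).
  rewrite E2 ev_r ev_l !vcompA -ev_r E1 ev_l.
  by [].
- move=> w a c s.
  have [w' [n [b [Jn e]]]] := cover (back p1 ∘ a) (J_back p2).
  have [s' es'] := restrict_ex s n.
  have [k ek] : exists k : back p1 ∘ (a ∘ n) ⇒ back p2 ∘ b,
      tot k = total_id (back p1 ∘ (a ∘ n)) by apply: idcell_ex; rewrite -e; arrows.
  have [s2 es2] : exists z : back p2 ∘ b ⇒ back p3 ∘ (c ∘ n), tot z = tot s'.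
    by apply: cast_ex; rewrite -?e; arrows.
  exists w', n, s', (ev t1 k • ev t2 s2); do 2 split=> //.
  exists b, k, s2; do 2 split=> //.
  by apply: tot_inj; rewrite (tot_absorb_l _ ek).
Qed.

(** The formula for a general [s1] follows from the case of an identity by
    naturality: locally [s1] is an identity followed by the image of a
    2-arrow [d] between middle elements. *)
Lemma vcomp_map_ex : exists t : fraction_map p1 p3,
  forall w a b c (s1 : back p1 ∘ a ⇒ back p2 ∘ b)
    (s2 : back p2 ∘ b ⇒ back p3 ∘ c),
  ev t (w := w) (s1 • s2) = ev t1 s1 • ev t2 s2.
Proof.
have [t et] := map_of_local vcomp_rel_local; exists t => w a b c s1 s2.
have [w' [n [b' [Jn e]]]] := cover (back p1 ∘ a) (J_back p2).
have [s1' es1'] := restrict_ex s1 n; have [s2' es2'] := restrict_ex s2 n.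
have [k ek] : exists k : back p1 ∘ (a ∘ n) ⇒ back p2 ∘ b',
    tot k = total_id (back p1 ∘ (a ∘ n)) by apply: idcell_ex; rewrite -e; arrows.
have [d ed] : exists d : b' ⇒ b ∘ n, tot (back p2 ◁ d) = tot s1'.
  by apply: (lift_ex (J_back p2)); rewrite -?e; arrows.
have E1 : s1' = k • back p2 ◁ d.
  by apply: tot_inj; rewrite (tot_absorb_l _ ek).
apply/tot_inj/(descent_inj Jn) => //.
transitivity (tot (ev t (s1' • s2'))).
  symmetry; apply: ev_whisk => //; rewrite rwhisk_V; exact: tot_vcomp.
transitivity (tot (ev t1 s1' • ev t2 s2')); last first.
  by rewrite rwhisk_V; apply: tot_vcomp; apply: ev_whisk.
rewrite E1 -vcompA ev_r -vcompA -ev_l.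
by congr tot; apply: et; exists b', k, (back p2 ◁ d • s2').
Qed.
End Vertical.

Section Horizontal.
Variables (x y z : ob S).

Lemma total_link (p : fraction x y) (q : fraction y z) (w : ob S)
  (c : total w (fapex (comp_fraction q p))) :
  total_lw (fwd p) (total_lw (pr1 (link p q)) c) =
  total_lw (back q) (total_lw (pr2 (link p q)) c).
Proof. exact: total_square. Qed.

Lemma link_square (p : fraction x y) (q : fraction y z) (w : ob S)
  (a : hom w (fapex (comp_fraction q p))) :
  fwd p ∘ (pr1 (link p q) ∘ a) = back q ∘ (pr2 (link p q) ∘ a).
Proof. by rewrite -!comp_assoc /link square. Qed.

Section Post.
Variables (p p' : fraction x y) (t : fraction_map p p') (q : fraction y z).
Let P := comp_fraction q p.
Let P' := comp_fraction q p'.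

(** The value of [t] is a 2-arrow between 1-arrows that factor through
    [back q], so it lifts to [l]. *)
Definition post_rel : value_relation P P' := fun w a b s r =>
  exists (s' : back p ∘ (pr1 (link p q) ∘ a) ⇒
               back p' ∘ (pr1 (link p' q) ∘ b))
         (l : pr2 (link p q) ∘ a ⇒ pr2 (link p' q) ∘ b),
  tot s' = tot s /\ tot (back q ◁ l) = tot (ev t s') /\
  tot r = tot (fwd q ◁ l).

Lemma post_data w (a : hom w (fapex P)) (b : hom w (fapex P'))
  (s : back P ∘ a ⇒ back P' ∘ b) :
  exists (s' : back p ∘ (pr1 (link p q) ∘ a) ⇒
               back p' ∘ (pr1 (link p' q) ∘ b))
         (l : pr2 (link p q) ∘ a ⇒ pr2 (link p' q) ∘ b),
  tot s' = tot s /\ tot (back q ◁ l) = tot (ev t s').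
Proof.
have [s' es'] : exists s' : back p ∘ (pr1 (link p q) ∘ a) ⇒
   back p' ∘ (pr1 (link p' q) ∘ b), tot s' = tot s.
  by apply: cast_ex; rewrite /=; arrows.
have [l el] := lift_ex (J_back q) (ev t s') (link_square a) (link_square b).
by exists s', l.
Qed.

Lemma post_map_ex : exists u : fraction_map P P',
  forall w a b s r, post_rel (w := w) (a := a) (b := b) s r -> ev u s = r.
Proof.
apply: map_of_local; split.
- move=> w w' m a b s r s' r' [s1 [l [e1 [el er]]]] es' er'.
  have [l' el'] : exists l' : pr2 (link p q) ∘ (a ∘ m) ⇒
      pr2 (link p' q) ∘ (b ∘ m), tot l' = tot (l ▷ m) by cast.
  have [s2 es2] : exists s2 : back p ∘ (pr1 (link p q) ∘ (a ∘ m)) ⇒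
      back p' ∘ (pr1 (link p' q) ∘ (b ∘ m)), tot s2 = tot (s1 ▷ m) by cast.
  exists s2, l'; split; first by rewrite es' es2 !tot_rw e1.
  split; last by rewrite er' tot_rw er !tot_lw el'; whiskers.
  rewrite (ev_whisk _ (m := m) (s := s1)); arrows.
  by rewrite tot_rw -el !tot_lw el'; whiskers.
- move=> w a a' b b' f s g r r' [s1 [l [e1 [el er]]]] [s2 [l' [e2 [el' er']]]].
  have E2 : s2 = back p ◁ (pr1 (link p q) ◁ f) • s1 •
      back p' ◁ (pr1 (link p' q) ◁ g).
    apply: tot_inj; rewrite e2.
    by apply: tot_vcomp; [apply: tot_vcomp |]; rewrite ?e1 //=; whiskers.
  rewrite E2 ev_r ev_l in el'.
  have E : l' = pr2 (link p q) ◁ f • l • pr2 (link p' q) ◁ g.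
    apply/tot_inj/(lift_inj (J_back q)) => //; rewrite el' !lwhisk_V.
    by apply: tot_vcomp; [apply: tot_vcomp |]; rewrite ?el //; whiskers;
      rewrite total_link.
  apply: tot_inj; rewrite er' E !lwhisk_V.
  by apply: tot_vcomp; [apply: tot_vcomp |]; rewrite ?er //=; whiskers.
- move=> w a b s; exists w, (id1 w).
  have [s1 es1] := restrict_ex s (id1 w).
  have [s' [l [e el]]] := post_data s1.
  have [r er] : exists r : fwd P ∘ (a ∘ id1 w) ⇒ fwd P' ∘ (b ∘ id1 w),
    tot r = tot (fwd q ◁ l) by apply: cast_ex; rewrite /=; arrows.
  by exists s1, r; split; [exact: J_id | split=> //; exists s', l].
Qed.
End Post.

Section Pre.
Variables (p : fraction x y) (q q' : fraction y z) (t : fraction_map q q').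
Let P := comp_fraction q p.
Let P' := comp_fraction q' p.

(** The 2-arrow [s] lifts through [back p], and pushing the lift [l] forward gives an
    argument for [t]. *)
Definition pre_rel : value_relation P P' := fun w a b s r =>
  exists (l : pr1 (link p q) ∘ a ⇒ pr1 (link p q') ∘ b)
    (s' : back q ∘ (pr2 (link p q) ∘ a) ⇒ back q' ∘ (pr2 (link p q') ∘ b)),
  tot (back p ◁ l) = tot s /\ tot s' = tot (fwd p ◁ l) /\
  tot r = tot (ev t s').

Lemma pre_data w (a : hom w (fapex P)) (b : hom w (fapex P'))
  (s : back P ∘ a ⇒ back P' ∘ b) :
  exists (l : pr1 (link p q) ∘ a ⇒ pr1 (link p q') ∘ b)
    (s' : back q ∘ (pr2 (link p q) ∘ a) ⇒ back q' ∘ (pr2 (link p q') ∘ b)),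
  tot (back p ◁ l) = tot s /\ tot s' = tot (fwd p ◁ l).
Proof.
have [l el] : exists l : pr1 (link p q) ∘ a ⇒ pr1 (link p q') ∘ b,
    tot (back p ◁ l) = tot s by apply: (lift_ex (J_back p)); exact: comp_assoc.
have [s' es'] := cast_ex (fwd p ◁ l) (link_square a) (link_square b).
by exists l, s'.
Qed.

Lemma pre_map_ex : exists u : fraction_map P P',
  forall w a b s r, pre_rel (w := w) (a := a) (b := b) s r -> ev u s = r.
Proof.
apply: map_of_local; split.
- move=> w w' m a b s r s' r' [l [s1 [el [e1 er]]]] es' er'.
  have [l' el'] : exists l' : pr1 (link p q) ∘ (a ∘ m) ⇒
      pr1 (link p q') ∘ (b ∘ m), tot l' = tot (l ▷ m) by cast.
  have [s2 es2] : exists s2 : back q ∘ (pr2 (link p q) ∘ (a ∘ m)) ⇒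
      back q' ∘ (pr2 (link p q') ∘ (b ∘ m)), tot s2 = tot (s1 ▷ m) by cast.
  exists l', s2; split; first by rewrite es' (tot_rw s) -el tot_lw el'; whiskers.
  split; first by rewrite es2 tot_rw e1 !tot_lw el'; whiskers.
  rewrite er' (ev_whisk _ (m := m) (s := s1)); arrows.
  by rewrite !tot_rw er.
- move=> w a a' b b' f s g r r' [l [s1 [el [e1 er]]]] [l' [s2 [el' [e2 er']]]].
  have E : l' = pr1 (link p q) ◁ f • l • pr1 (link p q') ◁ g.
    apply/tot_inj/(lift_inj (J_back p)) => //; rewrite el' !lwhisk_V.
    by apply: tot_vcomp; [apply: tot_vcomp |]; rewrite ?el //=; whiskers.
  have E2 : s2 = back q ◁ (pr2 (link p q) ◁ f) • s1 •
      back q' ◁ (pr2 (link p q') ◁ g).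
    apply: tot_inj; rewrite e2 E !lwhisk_V.
    by apply: tot_vcomp; [apply: tot_vcomp |]; rewrite ?e1 //=; whiskers;
      rewrite total_link.
  apply: tot_inj; rewrite er' E2 ev_r ev_l.
  by apply: tot_vcomp; [apply: tot_vcomp |]; rewrite ?er //=; whiskers.
- move=> w a b s; exists w, (id1 w).
  have [s1 es1] := restrict_ex s (id1 w).
  have [l [s' [el e]]] := pre_data s1.
  have [r er] : exists r : fwd P ∘ (a ∘ id1 w) ⇒ fwd P' ∘ (b ∘ id1 w),
    tot r = tot (ev t s') by apply: cast_ex; rewrite /=; arrows.
  by exists s1, r; split; [exact: J_id | split=> //; exists l, s'].
Qed.
End Pre.
End Horizontal.
End Operations.

Section Bicategory.
Variable S : two_site.

Definition vcomp_map (x y : ob S) (p1 p2 p3 : fraction x y)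
  (t1 : fraction_map p1 p2) (t2 : fraction_map p2 p3) : fraction_map p1 p3 :=
  proj1_sig (constructive_indefinite_description _ (vcomp_map_ex t1 t2)).

Lemma ev_vcomp_map (x y : ob S) (p1 p2 p3 : fraction x y)
  (t1 : fraction_map p1 p2) (t2 : fraction_map p2 p3) w a b c
  (s1 : back p1 ∘ a ⇒ back p2 ∘ b) (s2 : back p2 ∘ b ⇒ back p3 ∘ c) :
  ev (vcomp_map t1 t2) (w := w) (s1 • s2) = ev t1 s1 • ev t2 s2.
Proof.
by rewrite /vcomp_map; case: constructive_indefinite_description => t e; apply: e.
Qed.

Definition post_map (x y z : ob S) (p p' : fraction x y) (t : fraction_map p p')
  (q : fraction y z) : fraction_map (comp_fraction q p) (comp_fraction q p') :=
  proj1_sig (constructive_indefinite_description _ (post_map_ex t q)).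

(** The projections of [a] and [b] are named by separate variables, so that the
    formula also applies to elements that are known only up to equality, such as
    the image of an element under a rebracketing. *)
Lemma ev_post_map (x y z : ob S) (p p' : fraction x y) (t : fraction_map p p')
  (q : fraction y z) w (a : hom w (fapex (comp_fraction q p)))
  (b : hom w (fapex (comp_fraction q p')))
  (s : back (comp_fraction q p) ∘ a ⇒ back (comp_fraction q p') ∘ b)
  (a1 : hom w (fapex p)) (b1 : hom w (fapex p'))
  (s' : back p ∘ a1 ⇒ back p' ∘ b1)
  (a2 b2 : hom w (fapex q)) (l : a2 ⇒ b2) :
  a1 = pr1 (link p q) ∘ a -> b1 = pr1 (link p' q) ∘ b ->
  a2 = pr2 (link p q) ∘ a -> b2 = pr2 (link p' q) ∘ b ->
  tot s' = tot s -> tot (back q ◁ l) = tot (ev t s') ->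
  tot (ev (post_map t q) s) = tot (fwd q ◁ l).
Proof.
move=> ? ? ? ?; subst; rewrite /post_map => es el.
case: constructive_indefinite_description => u e /=.
have [r er] : exists r : fwd (comp_fraction q p) ∘ a ⇒
    fwd (comp_fraction q p') ∘ b, tot r = tot (fwd q ◁ l).
  by apply: cast_ex; rewrite /=; arrows.
by rewrite (e _ _ _ _ r) //; exists s', l.
Qed.

Definition pre_map (x y z : ob S) (q q' : fraction y z) (t : fraction_map q q')
  (p : fraction x y) : fraction_map (comp_fraction q p) (comp_fraction q' p) :=
  proj1_sig (constructive_indefinite_description _ (pre_map_ex p t)).

Lemma ev_pre_map (x y z : ob S) (q q' : fraction y z) (t : fraction_map q q')
  (p : fraction x y) w (a : hom w (fapex (comp_fraction q p)))
  (b : hom w (fapex (comp_fraction q' p)))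
  (s : back (comp_fraction q p) ∘ a ⇒ back (comp_fraction q' p) ∘ b)
  (a1 b1 : hom w (fapex p)) (l : a1 ⇒ b1)
  (a2 : hom w (fapex q)) (b2 : hom w (fapex q'))
  (s' : back q ∘ a2 ⇒ back q' ∘ b2) :
  a1 = pr1 (link p q) ∘ a -> b1 = pr1 (link p q') ∘ b ->
  a2 = pr2 (link p q) ∘ a -> b2 = pr2 (link p q') ∘ b ->
  tot (back p ◁ l) = tot s -> tot s' = tot (fwd p ◁ l) ->
  tot (ev (pre_map t p) s) = tot (ev t s').
Proof.
move=> ? ? ? ?; subst; rewrite /pre_map => el es.
case: constructive_indefinite_description => u e /=.
have [r er] : exists r : fwd (comp_fraction q p) ∘ a ⇒
    fwd (comp_fraction q' p) ∘ b, tot r = tot (ev t s').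
  by apply: cast_ex; rewrite /=; arrows.
by rewrite (e _ _ _ _ r) //; exists l, s'.
Qed.

(** * Maps induced by 1-arrows between apexes *)

Section Compare.
Variables (x y : ob S) (p q r : fraction x y).
Variables (c : hom (fapex p) (fapex r)) (d : hom (fapex q) (fapex r)).
Hypotheses (ebc : back r ∘ c = back p) (efc : fwd r ∘ c = fwd p).
Hypotheses (ebd : back r ∘ d = back q) (efd : fwd r ∘ d = fwd q).

Let R : value_relation p q := fun w a b s u => exists l : c ∘ a ⇒ d ∘ b,
  tot (back r ◁ l) = tot s /\ tot u = tot (fwd r ◁ l).

Lemma compare_local : is_local R.
Proof.
split.
- move=> w w' m a b s u s' u' [l [el eu]] es' eu'.
  have [l' el'] : exists l' : c ∘ (a ∘ m) ⇒ d ∘ (b ∘ m), tot l' = tot (l ▷ m)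
    by cast.
  exists l'; split; first by rewrite es' (tot_rw s) -el tot_lw el'; whiskers.
  by rewrite eu' (tot_rw u) eu (tot_lw _ l') el'; whiskers.
- move=> w a a' b b' f s g u u' [l [el eu]] [l' [el' eu']].
  have E : l' = c ◁ f • l • d ◁ g.
    apply/tot_inj/(lift_inj (J_back r)) => //; rewrite el' !lwhisk_V.
    by apply: tot_vcomp; [apply: tot_vcomp |]; rewrite ?el //=
      -?ebc -?ebd; whiskers.
  apply: tot_inj; rewrite eu' E !lwhisk_V.
  by apply: tot_vcomp; [apply: tot_vcomp |]; rewrite ?eu //=
    -?efc -?efd; whiskers.
- move=> w a b s; exists w, (id1 w).
  have [s1 es1] := restrict_ex s (id1 w).
  have [l el] : exists l : c ∘ (a ∘ id1 w) ⇒ d ∘ (b ∘ id1 w),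
      tot (back r ◁ l) = tot s1.
    by apply: (lift_ex (J_back r)); rewrite -?ebc -?ebd; arrows.
  have [u eu] : exists u : fwd p ∘ (a ∘ id1 w) ⇒ fwd q ∘ (b ∘ id1 w),
    tot u = tot (fwd r ◁ l) by apply: cast_ex; rewrite -?efc -?efd; arrows.
  by exists s1, u; split; [exact: J_id | split=> //; exists l].
Qed.

(** Two fractions that both map to a third one [r] are compared by lifting through
    [back r].  With [d] an identity this gives the map induced by [c], and with
    [c] an identity the inverse of the map induced by [d]. *)
Lemma compare_ex : exists t : fraction_map p q,
  forall w a b (s : back p ∘ a ⇒ back q ∘ b) a' b' (l : a' ⇒ b'),
    a' = c ∘ a -> b' = d ∘ b ->
    tot (back r ◁ l) = tot s -> tot (ev t (w := w) s) = tot (fwd r ◁ l).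
Proof.
have [t et] := map_of_local compare_local.
exists t => w a b s a' b' l ? ?; subst=> el.
have [u eu] : exists u : fwd p ∘ a ⇒ fwd q ∘ b,
  tot u = tot (fwd r ◁ l) by apply: cast_ex; rewrite -?efc -?efd; arrows.
by rewrite (et _ _ _ _ u) //; exists l.
Qed.

End Compare.

(** These are the maps with no content besides a change of apex: identities,
    unitors and associators are all of this form. *)
Definition induced (x y : ob S) (p q : fraction x y)
  (c : hom (fapex p) (fapex q)) (t : fraction_map p q) : Prop :=
  back q ∘ c = back p /\ fwd q ∘ c = fwd p /\
  forall w a b (s : back p ∘ a ⇒ back q ∘ b) a' (l : a' ⇒ b),
    a' = c ∘ a -> tot (back q ◁ l) = tot s ->
    tot (ev t (w := w) s) = tot (fwd q ◁ l).

Lemma induced_ex (x y : ob S) (p q : fraction x y)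
  (c : hom (fapex p) (fapex q)) :
  back q ∘ c = back p -> fwd q ∘ c = fwd p -> exists t, induced c t.
Proof.
move=> eb ef.
have [t et] := compare_ex eb ef (comp_id_r (back q)) (comp_id_r (fwd q)).
exists t; do 2 split=> //; move=> w a b s a' l ea el.
by apply: et => //; arrows.
Qed.

Lemma induced_uniq (x y : ob S) (p q : fraction x y)
  (c : hom (fapex p) (fapex q)) (t t' : fraction_map p q) :
  induced c t -> induced c t' -> t = t'.
Proof.
move=> [eb [ef h]] [_ [_ h']]; apply: ev_inj => w a b s.
have [l el] : exists l : c ∘ a ⇒ b, tot (back q ◁ l) = tot s.
  by apply: (lift_ex (J_back q)); rewrite -?eb; arrows.
by apply: tot_inj; rewrite (h _ _ _ _ _ l) // (h' _ _ _ _ _ l).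
Qed.

Definition id_map (x y : ob S) (p : fraction x y) : fraction_map p p :=
  proj1_sig (constructive_indefinite_description _
    (induced_ex (comp_id_r (back p)) (comp_id_r (fwd p)))).

Lemma id_map_induced (x y : ob S) (p : fraction x y) : induced (id1 _) (id_map p).
Proof. by rewrite /id_map; case: constructive_indefinite_description. Qed.

Lemma ev_id_map (x y : ob S) (p : fraction x y) w (a b : hom w (fapex p))
  (l : a ⇒ b) : ev (id_map p) (back p ◁ l) = fwd p ◁ l.
Proof.
have [_ [_ h]] := id_map_induced p.
by apply: tot_inj; apply: (h _ _ _ _ _ l); arrows.
Qed.

(** Every 2-arrow between elements factors locally through an element of any given
    fraction, so maps may be compared on composites only. *)
Lemma ev_inj_via (x y z : ob S) (r : fraction x z) (p q : fraction x y)
  (t t' : fraction_map p q) :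
  (forall w a b c (s1 : back p ∘ a ⇒ back r ∘ b) (s2 : back r ∘ b ⇒ back q ∘ c),
    ev t (w := w) (s1 • s2) = ev t' (s1 • s2)) -> t = t'.
Proof.
move=> h; apply: ev_inj => w a c s.
have [w' [n [b [Jn e]]]] := cover (back p ∘ a) (J_back r).
have [s' es'] := restrict_ex s n.
have [k ek] : exists k : back p ∘ (a ∘ n) ⇒ back r ∘ b,
    tot k = total_id (back p ∘ (a ∘ n)) by apply: idcell_ex; rewrite -e; arrows.
have [s2 es2] : exists s2 : back r ∘ b ⇒ back q ∘ (c ∘ n), tot s2 = tot s'.
  by apply: cast_ex; rewrite -?e; arrows.
apply/tot_inj/(descent_inj Jn) => //.
rewrite -(ev_whisk t _ _ es') // -(ev_whisk t' _ _ es') //.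
have -> : s' = k • s2 by apply: tot_inj; rewrite (tot_absorb_l _ ek).
by rewrite h.
Qed.

(** For laws in which the two sides are vertical composites through different
    middle fractions. *)
Lemma ev_inj_via2 (x y z z' : ob S) (r : fraction x z) (r' : fraction x z')
  (p q : fraction x y) (t t' : fraction_map p q) :
  (forall w a b b' c (s1 : back p ∘ a ⇒ back r ∘ b)
    (m : back r ∘ b ⇒ back r' ∘ b') (s2 : back r' ∘ b' ⇒ back q ∘ c),
    ev t (w := w) (s1 • (m • s2)) = ev t' (s1 • (m • s2))) -> t = t'.
Proof.
move=> h; apply: (ev_inj_via (r := r)) => w a b c s1 s2.
have [w' [n [b' [Jn e]]]] := cover (back r ∘ b) (J_back r').
have [s1' es1'] := restrict_ex s1 n; have [s2' es2'] := restrict_ex s2 n.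
have [k ek] : exists k : back r ∘ (b ∘ n) ⇒ back r' ∘ b',
    tot k = total_id (back r ∘ (b ∘ n)) by apply: idcell_ex; rewrite -e; arrows.
have [s3 es3] : exists s : back r' ∘ b' ⇒ back q ∘ (c ∘ n), tot s = tot s2'.
  by apply: cast_ex; rewrite -?e; arrows.
have E : tot (s1' • (k • s3)) = tot ((s1 • s2) ▷ n).
  by rewrite rwhisk_V; apply: tot_vcomp; rewrite // (tot_absorb_l _ ek) es3.
apply/tot_inj/(descent_inj Jn) => //.
by rewrite -(ev_whisk t _ _ E) // -(ev_whisk t' _ _ E) // h.
Qed.

(** An element of the target lifts locally to [r] over the base, and is then
    isomorphic to the image under [c] of its lift; naturality does the rest. *)
Lemma ev_inj_along (x y z : ob S) (p q : fraction x y) (r : fraction x z)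
  (c : hom (fapex r) (fapex q)) (t t' : fraction_map p q) :
  back q ∘ c = back r ->
  (forall w a b (s : back p ∘ a ⇒ back q ∘ (c ∘ b)),
    ev t (w := w) s = ev t' s) -> t = t'.
Proof.
move=> ec h; apply: (ev_inj_via (r := r)) => w a b b' s1 s2.
have [s1' es1'] : exists s : back p ∘ a ⇒ back q ∘ (c ∘ b), tot s = tot s1.
  by apply: cast_ex; rewrite -?ec; arrows.
have [l el] : exists l : c ∘ b ⇒ b', tot (back q ◁ l) = tot s2.
  by apply: (lift_ex (J_back q)); rewrite -?ec; arrows.
have -> : s1 • s2 = s1' • back q ◁ l by apply/tot_inj/tot_vcomp.
by rewrite !ev_r h.
Qed.

(** The middle element can be taken to be the image [c ∘ a], over which the value of
    the first map is an identity. *)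
Lemma induced_comp (x y : ob S) (p q r : fraction x y)
  (c : hom (fapex p) (fapex q)) (d : hom (fapex q) (fapex r)) t u :
  induced c t -> induced d u -> induced (d ∘ c) (vcomp_map t u).
Proof.
move=> [ebc [efc ht]] [ebd [efd hu]].
split; first by rewrite -comp_assoc ebd.
split; first by rewrite -comp_assoc efd.
move=> w a b s a' l ? el; subst.
have [k ek] : exists k : back p ∘ a ⇒ back q ∘ (c ∘ a),
  tot k = total_id (back p ∘ a) by apply: idcell_ex; rewrite -ebc; arrows.
have [s' es'] : exists z : back q ∘ (c ∘ a) ⇒ back r ∘ b, tot z = tot s.
  by apply: cast_ex; rewrite -?ebc; arrows.
have -> : s = k • s' by apply: tot_inj; rewrite (tot_absorb_l _ ek).
rewrite ev_vcomp_map (tot_absorb_l (f' := fwd q ∘ (c ∘ a))).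
  rewrite (ht _ _ _ _ _ (@id2 _ (two_ops S) _ _ (c ∘ a))) //; whiskers => //.
  by rewrite ek -ebc; arrows.
by apply: (hu _ _ _ _ _ l); arrows; rewrite es'.
Qed.

Lemma ev_induced_l (x y : ob S) (p q r : fraction x y)
  (c : hom (fapex p) (fapex q)) t (u : fraction_map q r) w a b
  (s : back p ∘ a ⇒ back r ∘ b) (s' : back q ∘ (c ∘ a) ⇒ back r ∘ b) :
  induced c t -> tot s' = tot s ->
  tot (ev (vcomp_map t u) (w := w) s) = tot (ev u s').
Proof.
move=> [ebc [efc ht]] es'.
have [k ek] : exists k : back p ∘ a ⇒ back q ∘ (c ∘ a),
  tot k = total_id (back p ∘ a) by apply: idcell_ex; rewrite -ebc; arrows.
have -> : s = k • s' by apply: tot_inj; rewrite (tot_absorb_l _ ek).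
rewrite ev_vcomp_map (tot_absorb_l (f' := fwd q ∘ (c ∘ a))) //.
rewrite (ht _ _ _ _ _ (@id2 _ (two_ops S) _ _ (c ∘ a))) //; whiskers => //.
by rewrite ek -ebc; arrows.
Qed.

Lemma ev_induced_r (x y : ob S) (p q r : fraction x y)
  (c : hom (fapex q) (fapex r)) t (u : fraction_map p q) w a b
  (s : back p ∘ a ⇒ back r ∘ (c ∘ b)) (s' : back p ∘ a ⇒ back q ∘ b) :
  induced c t -> tot s' = tot s ->
  tot (ev (vcomp_map u t) (w := w) s) = tot (ev u s').
Proof.
move=> [ebc [efc ht]] es'.
have [k ek] : exists k : back q ∘ b ⇒ back r ∘ (c ∘ b),
  tot k = total_id (back q ∘ b) by apply: idcell_ex; rewrite -ebc; arrows.
have -> : s = s' • k by apply: tot_inj; rewrite (tot_absorb_r _ ek).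
rewrite ev_vcomp_map (tot_absorb_r (f' := fwd r ∘ (c ∘ b))) //.
rewrite (ht _ _ _ _ _ (@id2 _ (two_ops S) _ _ (c ∘ b))) //; whiskers => //.
by rewrite ek -ebc; arrows.
Qed.

Lemma induced_iso (x y : ob S) (p q : fraction x y)
  (c : hom (fapex p) (fapex q)) t : induced c t ->
  exists u, vcomp_map t u = id_map p /\ vcomp_map u t = id_map q.
Proof.
move=> it; have [ebc [efc ht]] := it.
have [u hu] := compare_ex (comp_id_r (back q)) (comp_id_r (fwd q)) ebc efc.
exists u; split.
  apply: ev_inj => w a b s.
  have [l el] : exists l : a ⇒ b, tot (back p ◁ l) = tot s.
    by apply: (lift_ex (J_back p)).
  rewrite -(tot_inj el) ev_id_map; apply: tot_inj.
  have [s' es'] : exists z : back q ∘ (c ∘ a) ⇒ back p ∘ b,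
      tot z = tot (back p ◁ l).
    by apply: cast_ex; rewrite -?ebc; arrows.
  rewrite (ev_induced_l _ it es').
  rewrite (hu _ _ _ _ (c ∘ a) (c ∘ b) (c ◁ l)); arrows.
    by rewrite es' -ebc; whiskers.
  by rewrite -efc; whiskers.
apply: (ev_inj_along (c := c) ebc) => w a b s.
have [l el] : exists l : a ⇒ c ∘ b, tot (back q ◁ l) = tot s.
  by apply: (lift_ex (J_back q)).
rewrite -(tot_inj el) ev_id_map; apply: tot_inj.
have [s' es'] : exists z : back q ∘ a ⇒ back p ∘ b, tot z = tot (back q ◁ l).
  by apply: cast_ex; rewrite -?ebc; arrows.
rewrite (ev_induced_r _ it es').
by apply: hu; arrows.
Qed.

(** * The laws of a bicategory *)

Lemma id_map_vcomp (x y : ob S) (p q : fraction x y) (t : fraction_map p q) :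
  vcomp_map (id_map p) t = t.
Proof.
apply: ev_inj => w a b s; apply: tot_inj.
have [s' es'] : exists s' : back p ∘ (id1 _ ∘ a) ⇒ back q ∘ b, tot s' = tot s
  by cast.
rewrite (ev_induced_l _ (id_map_induced p) es').
by apply: ev_congr; arrows.
Qed.

Lemma vcomp_map_id (x y : ob S) (p q : fraction x y) (t : fraction_map p q) :
  vcomp_map t (id_map q) = t.
Proof.
apply: ev_inj => w a b s; apply: tot_inj.
have [s' es'] : exists s' : back p ∘ a ⇒ back q ∘ (id1 _ ∘ b), tot s' = tot s
  by cast.
rewrite -(ev_induced_r t (id_map_induced q) (eq_sym es')).
by apply: ev_congr; arrows.
Qed.

Lemma vcomp_map_assoc (x y : ob S) (p1 p2 p3 p4 : fraction x y)
  (t1 : fraction_map p1 p2) (t2 : fraction_map p2 p3) (t3 : fraction_map p3 p4) :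
  vcomp_map t1 (vcomp_map t2 t3) = vcomp_map (vcomp_map t1 t2) t3.
Proof.
apply: (ev_inj_via2 (r := p2) (r' := p3)) => w a b b' c s1 m s2.
by rewrite [in RHS]vcompA !ev_vcomp_map vcompA.
Qed.

Lemma post_map_id (x y z : ob S) (p : fraction x y) (q : fraction y z) :
  post_map (id_map p) q = id_map (comp_fraction q p).
Proof.
apply: ev_inj => w a b s.
have [l el] := lift_ex (J_back (comp_fraction q p)) s eq_refl eq_refl.
rewrite -(tot_inj el) ev_id_map; apply: tot_inj.
rewrite (ev_post_map (s' := back p ◁ (pr1 (link p q) ◁ l))
  (l := pr2 (link p q) ◁ l)) //=; whiskers => //.
by rewrite ev_id_map; whiskers; rewrite total_link.
Qed.

Lemma post_map_vcomp (x y z : ob S) (p1 p2 p3 : fraction x y)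
  (t1 : fraction_map p1 p2) (t2 : fraction_map p2 p3) (q : fraction y z) :
  post_map (vcomp_map t1 t2) q = vcomp_map (post_map t1 q) (post_map t2 q).
Proof.
apply: (ev_inj_via (r := comp_fraction q p2)) => w a b c s1 s2.
rewrite ev_vcomp_map; apply: tot_inj.
have [s1' [l1 [e1 el1]]] := post_data t1 s1.
have [s2' [l2 [e2 el2]]] := post_data t2 s2.
rewrite (ev_post_map (s' := s1' • s2') (l := l1 • l2)) //.
- exact: tot_vcomp.
- by rewrite ev_vcomp_map lwhisk_V; apply: tot_vcomp.
- by rewrite lwhisk_V; apply: tot_vcomp; symmetry;
    [apply: (ev_post_map (s' := s1')) | apply: (ev_post_map (s' := s2'))].
Qed.

Lemma pre_map_id (x y z : ob S) (p : fraction x y) (q : fraction y z) :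
  pre_map (id_map q) p = id_map (comp_fraction q p).
Proof.
apply: ev_inj => w a b s.
have [l el] := lift_ex (J_back (comp_fraction q p)) s eq_refl eq_refl.
rewrite -(tot_inj el) ev_id_map; apply: tot_inj.
rewrite (ev_pre_map _ (l := pr1 (link p q) ◁ l)
  (s' := back q ◁ (pr2 (link p q) ◁ l))) //=; whiskers => //.
- by rewrite total_link.
- by rewrite ev_id_map; whiskers.
Qed.

Lemma pre_map_vcomp (x y z : ob S) (q1 q2 q3 : fraction y z)
  (t1 : fraction_map q1 q2) (t2 : fraction_map q2 q3) (p : fraction x y) :
  pre_map (vcomp_map t1 t2) p = vcomp_map (pre_map t1 p) (pre_map t2 p).
Proof.
apply: (ev_inj_via (r := comp_fraction q2 p)) => w a b c s1 s2.
rewrite ev_vcomp_map; apply: tot_inj.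
have [l1 [s1' [el1 e1]]] := pre_data s1.
have [l2 [s2' [el2 e2]]] := pre_data s2.
rewrite (ev_pre_map _ (l := l1 • l2) (s' := s1' • s2')) //.
- by rewrite lwhisk_V; apply: tot_vcomp.
- by rewrite lwhisk_V; apply: tot_vcomp.
- by rewrite ev_vcomp_map; apply: tot_vcomp; symmetry;
    [apply: (ev_pre_map _ (l := l1)) | apply: (ev_pre_map _ (l := l2))].
Qed.

(** For s = s1 • m • s2 both sides are equal to the value of [u] at the value of
    [t] at s.  On the left naturality of [ev u] absorbs the lift [k1] of the
    first half of that value, on the right the lift [k2] of the second half. *)
Lemma interchange_map (x y z : ob S) (p p' : fraction x y) (q q' : fraction y z)
  (t : fraction_map p p') (u : fraction_map q q') :
  vcomp_map (post_map t q) (pre_map u p') =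
  vcomp_map (pre_map u p) (post_map t q').
Proof.
apply: (ev_inj_via2 (r := comp_fraction q' p) (r' := comp_fraction q p')).
move=> w a b b' c s1 m s2.
rewrite [in LHS]vcompA !ev_vcomp_map; apply: tot_inj.
have [l1 [v1 [el1 ev1]]] := pre_data s1.
have [l2 [v2 [el2 ev2]]] := pre_data s2.
have [m' em'] : exists z : back p ∘ (pr1 (link p q') ∘ b) ⇒
    back p' ∘ (pr1 (link p' q) ∘ b'), tot z = tot m.
  by apply: cast_ex; rewrite /=; arrows.
pose s := back p ◁ l1 • m' • back p' ◁ l2.
have [k1 ek1] := lift_ex (J_back q) (ev t (back p ◁ l1 • m'))
  (link_square _) (link_square _).
have [k2 ek2] := lift_ex (J_back q') (ev t (m' • back p' ◁ l2))
  (link_square _) (link_square _).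
transitivity (tot (fwd q ◁ k1 • ev u v2)).
  apply: tot_vcomp.
    apply: (ev_post_map (s' := back p ◁ l1 • m')) => //.
    by apply: tot_vcomp.
  by apply: (ev_pre_map _ (l := l2)).
transitivity (tot (ev u v1 • fwd q' ◁ k2)); last first.
  apply: tot_vcomp; symmetry.
    by apply: (ev_pre_map _ (l := l1)).
  apply: (ev_post_map (s' := m' • back p' ◁ l2)) => //.
  by apply: tot_vcomp.
rewrite -ev_l -ev_r; congr (tot (ev u _)); apply: tot_inj.
transitivity (tot (ev t (back p ◁ l1 • m' • back p' ◁ l2))).
  by rewrite ev_r; apply: tot_vcomp.
by rewrite -vcompA ev_l; symmetry; apply: tot_vcomp.
Qed.

(** The pullback of an identity is an identity only propositionally, and so is
    the unit law for fractions.  Stated for an arbitrary span [s] equal to the trivial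
    one, the transport of the identity map can be computed by
    induction on that equality; it is induced by the projection. *)
Lemma transport_unit_l (x y : ob S) (p : fraction x y) (s : span (fapex p) y)
  (H : J (back p ∘ pr1 s)) : s = Span (id1 (fapex p)) (fwd p) ->
  exists e : Fraction (id1 y ∘ pr2 s) H = p,
    induced (p := Fraction (id1 y ∘ pr2 s) H) (pr1 s)
      (match e in _ = p' return fraction_map _ p' with eq_refl => id_map _ end).
Proof.
move=> es; subst s; case: p H => u j f Jj /=.
have gen (j' : hom u x) (f' : hom u y) (H : J j') : j' = j -> f' = f ->
    exists e : Fraction f' H = Fraction f Jj,
    induced (p := Fraction f' H) (q := Fraction f Jj) (id1 u)
      (match e in _ = p' return fraction_map _ p' with eq_refl => id_map _ end).
  move=> ? ?; subst; rewrite (proof_irrelevance _ H Jj).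
  by exists eq_refl; exact: id_map_induced.
by move=> H; apply: gen; arrows.
Qed.

Lemma transport_unit_r (x y : ob S) (p : fraction x y) (s : span x (fapex p))
  (H : J (id1 x ∘ pr1 s)) : s = Span (back p) (id1 (fapex p)) ->
  exists e : Fraction (fwd p ∘ pr2 s) H = p,
    induced (p := Fraction (fwd p ∘ pr2 s) H) (pr2 s)
      (match e in _ = p' return fraction_map _ p' with eq_refl => id_map _ end).
Proof.
move=> es; subst s; case: p H => u j f Jj /=.
have gen (j' : hom u x) (f' : hom u y) (H : J j') : j' = j -> f' = f ->
    exists e : Fraction f' H = Fraction f Jj,
    induced (p := Fraction f' H) (q := Fraction f Jj) (id1 u)
      (match e in _ = p' return fraction_map _ p' with eq_refl => id_map _ end).
  move=> ? ?; subst; rewrite (proof_irrelevance _ H Jj).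
  by exists eq_refl; exact: id_map_induced.
by move=> H; apply: gen; arrows.
Qed.

Lemma comp_fraction_id_l (x y : ob S) (p : fraction x y) :
  comp_fraction (id_fraction y) p = p.
Proof.
by have [e _] := transport_unit_l
  (J_comp (J_back p) (J_pr1 (fwd p) (J_back (id_fraction y)))) (pb_id_r _ _).
Qed.

Lemma comp_fraction_id_r (x y : ob S) (p : fraction x y) :
  comp_fraction p (id_fraction x) = p.
Proof.
by have [e _] := transport_unit_r (p := p)
  (J_comp (J_id x) (J_pr1 (id1 x) (J_back p))) (pb_id_l _).
Qed.

Definition lunitor_map (x y : ob S) (p : fraction x y) :
  fraction_map (comp_fraction (id_fraction y) p) p :=
  match comp_fraction_id_l p in _ = p' return fraction_map _ p' with
    eq_refl => id_map _ end.

Definition runitor_map (x y : ob S) (p : fraction x y) :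
  fraction_map (comp_fraction p (id_fraction x)) p :=
  match comp_fraction_id_r p in _ = p' return fraction_map _ p' with
    eq_refl => id_map _ end.

Lemma lunitor_map_induced (x y : ob S) (p : fraction x y) :
  induced (p := comp_fraction (id_fraction y) p)
    (pr1 (link p (id_fraction y))) (lunitor_map p).
Proof.
have [e] := transport_unit_l
  (J_comp (J_back p) (J_pr1 (fwd p) (J_back (id_fraction y)))) (pb_id_r _ _).
rewrite /lunitor_map.
by rewrite (proof_irrelevance _ (comp_fraction_id_l p) e).
Qed.

Lemma runitor_map_induced (x y : ob S) (p : fraction x y) :
  induced (p := comp_fraction p (id_fraction x))
    (pr2 (link (id_fraction x) p)) (runitor_map p).
Proof.
have [e] := transport_unit_r (p := p)
  (J_comp (J_id x) (J_pr1 (id1 x) (J_back p))) (pb_id_l _).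
rewrite /runitor_map.
by rewrite (proof_irrelevance _ (comp_fraction_id_r p) e).
Qed.

Lemma lunitor_map_natural (x y : ob S) (p q : fraction x y)
  (t : fraction_map p q) :
  vcomp_map (post_map t (id_fraction y)) (lunitor_map q) =
  vcomp_map (lunitor_map p) t.
Proof.
apply: (ev_inj_along (r := comp_fraction (id_fraction y) q)
  (c := pr1 (link q (id_fraction y)))) => // w a b s; apply: tot_inj.
have [s1 es1] : exists s1 : back (comp_fraction (id_fraction y) p) ∘ a ⇒
    back (comp_fraction (id_fraction y) q) ∘ b, tot s1 = tot s.
  by apply: cast_ex; rewrite /=; arrows.
have [s2 [l [es2 el]]] := post_data t s1.
rewrite (ev_induced_r _ (lunitor_map_induced q) es1).
have es2' : tot s2 = tot s by rewrite es2.
rewrite (ev_induced_l _ (lunitor_map_induced p) es2').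
by rewrite (ev_post_map (s' := s2) (l := l)).
Qed.

Lemma runitor_map_natural (x y : ob S) (p q : fraction x y)
  (t : fraction_map p q) :
  vcomp_map (pre_map t (id_fraction x)) (runitor_map q) =
  vcomp_map (runitor_map p) t.
Proof.
have [eq _] := runitor_map_induced q.
apply: (ev_inj_along (r := comp_fraction q (id_fraction x))
  (c := pr2 (link (id_fraction x) q))) => // w a b s; apply: tot_inj.
have [s1 es1] : exists s1 : back (comp_fraction p (id_fraction x)) ∘ a ⇒
    back (comp_fraction q (id_fraction x)) ∘ b, tot s1 = tot s.
  by apply: cast_ex; rewrite // -eq; arrows.
have [l [s2 [el es2]]] := pre_data s1.
rewrite (ev_induced_r _ (runitor_map_induced q) es1).
have es2' : tot s2 = tot s by rewrite es2 -es1 -el.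
rewrite (ev_induced_l _ (runitor_map_induced p) es2').
by rewrite (ev_pre_map _ (l := l) (s' := s2)).
Qed.

Lemma comp_assoc_eq (w x y z : ob S) (a : hom y z) (b : hom x y) c :
  a ∘ b = c -> forall n : hom w x, a ∘ (b ∘ n) = c ∘ n.
Proof. by move=> <- n; rewrite comp_assoc. Qed.

Lemma comp_assoc_eq3 (v w x y z : ob S) (a : hom y z) (a' : hom x y)
  (b : hom w x) c :
  a ∘ (a' ∘ b) = c -> forall n : hom v w, a ∘ (a' ∘ (b ∘ n)) = c ∘ n.
Proof. by move=> <- n; rewrite !comp_assoc. Qed.

Lemma induced_post (x y z : ob S) (p p' : fraction x y) (q : fraction y z)
  (c : hom (fapex p) (fapex p')) (t : fraction_map p p')
  (c' : hom (fapex (comp_fraction q p)) (fapex (comp_fraction q p'))) :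
  induced c t ->
  pr1 (link p' q) ∘ c' = c ∘ pr1 (link p q) ->
  pr2 (link p' q) ∘ c' = pr2 (link p q) ->
  induced c' (post_map t q).
Proof.
move=> [eb [ef ht]] e1 e2; split; first by rewrite /= -eb; arrows; rewrite e1.
split; first by rewrite /=; arrows; rewrite e2.
move=> w a b s a' l ? el; subst.
have [l1 el1] : exists l1 : c ∘ (pr1 (link p q) ∘ a) ⇒ pr1 (link p' q) ∘ b,
    tot l1 = tot (pr1 (link p' q) ◁ l).
  by apply: cast_ex; rewrite // -!comp_assoc e1.
have [l2 el2] : exists l2 : pr2 (link p q) ∘ a ⇒ pr2 (link p' q) ∘ b,
    tot l2 = tot (pr2 (link p' q) ◁ l).
  by apply: cast_ex; rewrite // -!comp_assoc e2.
have [s1 es1] : exists s1 : back p ∘ (pr1 (link p q) ∘ a) ⇒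
  back p' ∘ (pr1 (link p' q) ∘ b), tot s1 = tot s.
  by apply: cast_ex; rewrite /=; arrows.
rewrite (ev_post_map (s' := s1) (l := l2)) //.
  rewrite (ht _ _ _ _ _ l1) //.
    by rewrite es1 -el tot_lw el1; whiskers.
  by rewrite !tot_lw el2 el1; whiskers; rewrite total_link.
by rewrite tot_lw el2; whiskers.
Qed.

Lemma induced_pre (x y z : ob S) (p : fraction x y) (q q' : fraction y z)
  (c : hom (fapex q) (fapex q')) (t : fraction_map q q')
  (c' : hom (fapex (comp_fraction q p)) (fapex (comp_fraction q' p))) :
  induced c t ->
  pr1 (link p q') ∘ c' = pr1 (link p q) ->
  pr2 (link p q') ∘ c' = c ∘ pr2 (link p q) ->
  induced c' (pre_map t p).
Proof.
move=> [eb [ef ht]] e1 e2; split; first by rewrite /=; arrows; rewrite e1.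
split; first by rewrite /= -ef; arrows; rewrite e2.
move=> w a b s a' l ? el; subst.
have [l1 el1] : exists l1 : pr1 (link p q) ∘ a ⇒ pr1 (link p q') ∘ b,
    tot l1 = tot (pr1 (link p q') ◁ l).
  by apply: cast_ex; rewrite // -!comp_assoc e1.
have [l2 el2] : exists l2 : c ∘ (pr2 (link p q) ∘ a) ⇒ pr2 (link p q') ∘ b,
    tot l2 = tot (pr2 (link p q') ◁ l).
  by apply: cast_ex; rewrite // -!comp_assoc e2.
have [s1 es1] := cast_ex (fwd p ◁ l1) (link_square a) (link_square b).
rewrite (ev_pre_map _ (l := l1) (s' := s1)) //.
  by rewrite -el tot_lw el1; whiskers.
rewrite (ht _ _ _ _ _ l2) //.
  by rewrite es1 !tot_lw el2 el1; whiskers; rewrite total_link.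
by rewrite tot_lw el2; whiskers.
Qed.

Lemma link_pair (x y z : ob S) (p : fraction x y) (q : fraction y z) (w : ob S)
  (a : hom w (fapex p)) (b : hom w (fapex q)) : fwd p ∘ a = back q ∘ b ->
  exists c : hom w (fapex (comp_fraction q p)),
    pr1 (link p q) ∘ c = a /\ pr2 (link p q) ∘ c = b.
Proof. exact: pair_ex. Qed.

Lemma link_eq (x y z : ob S) (p : fraction x y) (q : fraction y z) (w : ob S)
  (c d : hom w (fapex (comp_fraction q p))) :
  pr1 (link p q) ∘ c = pr1 (link p q) ∘ d ->
  pr2 (link p q) ∘ c = pr2 (link p q) ∘ d -> c = d.
Proof. exact: pair_eq. Qed.

Section Associator.
Variables (x1 x2 x3 x4 : ob S).
Variables (r : fraction x3 x4) (q : fraction x2 x3) (p : fraction x1 x2).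
Let F := comp_fraction (comp_fraction r q) p.
Let F' := comp_fraction r (comp_fraction q p).
Let L := link p (comp_fraction r q).
Let L' := link (comp_fraction q p) r.

Definition is_rebracketing (al : hom (fapex F) (fapex F')) : Prop :=
  pr1 (link p q) ∘ (pr1 L' ∘ al) = pr1 L /\
  pr2 (link p q) ∘ (pr1 L' ∘ al) = pr1 (link q r) ∘ pr2 L /\
  pr2 L' ∘ al = pr2 (link q r) ∘ pr2 L.

Lemma associator_map_ex : exists u : fraction_map F F',
  exists al : hom (fapex F) (fapex F'), is_rebracketing al /\ induced al u.
Proof.
have [c [c1 c2]] := link_pair (p := p) (q := q) (a := pr1 L)
  (b := pr1 (link q r) ∘ pr2 L)
  ltac:(by rewrite -comp_assoc /L /link square).
have [al [a1 a2]] := link_pair (w := fapex F) (p := comp_fraction q p)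
  (q := r) (a := c)
  (b := pr2 (link q r) ∘ pr2 L)
  ltac:(by rewrite /= comp_assoc c2 -!comp_assoc /link square).
have [u iu] : exists u : fraction_map F F', induced al u.
  apply: induced_ex; rewrite /F /F' /=; arrows.
    by rewrite a1 c1.
  by rewrite a2.
by exists u, al; split; rewrite // /is_rebracketing a1 a2.
Qed.

Definition associator_map : fraction_map F F' :=
  proj1_sig (constructive_indefinite_description _ associator_map_ex).

Lemma associator_map_induced :
  exists al : hom (fapex F) (fapex F'),
    is_rebracketing al /\ induced al associator_map.
Proof. by rewrite /associator_map; case: constructive_indefinite_description. Qed.

End Associator.

(** Each of the three naturality laws is checked at elements [a] and [al' ∘ b], for
    which the two associators do not change the values. *)
Lemma associator_map_natural_r (w x y z : ob S) (h : fraction y z)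
  (g : fraction x y) (f f' : fraction w x) (t : fraction_map f f') :
  vcomp_map (post_map t (comp_fraction h g)) (associator_map h g f') =
  vcomp_map (associator_map h g f) (post_map (post_map t g) h).
Proof.
have [al [[a1 [a2 a3]] ia]] := associator_map_induced h g f.
have [al' [[a1' [a2' a3']] ia']] := associator_map_induced h g f'.
have [eb _] := ia; have [eb' _] := ia'.
apply: (ev_inj_along (r := comp_fraction (comp_fraction h g) f')
  (c := al') eb').
move=> v a b s; apply: tot_inj.
have [s1 es1] : exists s1 : back (comp_fraction (comp_fraction h g) f) ∘ a ⇒
    back (comp_fraction (comp_fraction h g) f') ∘ b, tot s1 = tot s.
  by apply: cast_ex; rewrite -?eb' //; arrows.
have [s3 es3] : exists s3 :
    back (comp_fraction h (comp_fraction g f)) ∘ (al ∘ a) ⇒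
    back (comp_fraction h (comp_fraction g f')) ∘ (al' ∘ b), tot s3 = tot s.
  by apply: cast_ex; rewrite // -eb; arrows.
rewrite (ev_induced_r _ ia' es1) (ev_induced_l _ ia es3).
have [s2 [l [es2 el]]] := post_data t s1.
have [s4 es4] : exists s4 :
    back (comp_fraction g f) ∘ (pr1 (link (comp_fraction g f) h) ∘ (al ∘ a)) ⇒
    back (comp_fraction g f') ∘ (pr1 (link (comp_fraction g f') h) ∘ (al' ∘ b)),
    tot s4 = tot s3 by apply: cast_ex; rewrite /=; arrows.
rewrite (ev_post_map (s' := s2) (l := l)) //.
rewrite (ev_post_map (s' := s4) (l := pr2 (link g h) ◁ l)) //.
- by rewrite -!comp_assoc a3.
- by rewrite -!comp_assoc a3'.
- rewrite (ev_post_map (s' := s2) (l := pr1 (link g h) ◁ l)).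
  + by rewrite -a1; arrows.
  + by rewrite -a1'; arrows.
  + by rewrite -comp_assoc -a2; arrows.
  + by rewrite -comp_assoc -a2'; arrows.
  + by rewrite es4 es3 es2.
  + by rewrite -el /=; whiskers.
  + by whiskers; rewrite total_link.
- by rewrite /=; whiskers.
Qed.

Lemma associator_map_natural_m (w x y z : ob S) (h : fraction y z)
  (g g' : fraction x y) (f : fraction w x) (t : fraction_map g g') :
  vcomp_map (pre_map (post_map t h) f) (associator_map h g' f) =
  vcomp_map (associator_map h g f) (post_map (pre_map t f) h).
Proof.
have [al [[a1 [a2 a3]] ia]] := associator_map_induced h g f.
have [al' [[a1' [a2' a3']] ia']] := associator_map_induced h g' f.
have [eb _] := ia; have [eb' _] := ia'.
apply: (ev_inj_along (r := comp_fraction (comp_fraction h g') f)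
  (c := al') eb').
move=> v a b s; apply: tot_inj.
have [s1 es1] : exists s1 : back (comp_fraction (comp_fraction h g) f) ∘ a ⇒
    back (comp_fraction (comp_fraction h g') f) ∘ b, tot s1 = tot s.
  by apply: cast_ex; rewrite -?eb' //; arrows.
have [s3 es3] : exists s3 :
    back (comp_fraction h (comp_fraction g f)) ∘ (al ∘ a) ⇒
    back (comp_fraction h (comp_fraction g' f)) ∘ (al' ∘ b), tot s3 = tot s.
  by apply: cast_ex; rewrite // -eb; arrows.
rewrite (ev_induced_r _ ia' es1) (ev_induced_l _ ia es3).
have [l [s2 [el es2]]] := pre_data s1.
have [s5 [l2 [es5 el2]]] := post_data t s2.
have [s4 es4] : exists s4 :
    back (comp_fraction g f) ∘ (pr1 (link (comp_fraction g f) h) ∘ (al ∘ a)) ⇒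
    back (comp_fraction g' f) ∘ (pr1 (link (comp_fraction g' f) h) ∘ (al' ∘ b)),
    tot s4 = tot s3 by apply: cast_ex; rewrite /=; arrows.
rewrite (ev_pre_map _ (l := l) (s' := s2)) //.
rewrite (ev_post_map (s' := s5) (l := l2)) //.
rewrite (ev_post_map (s' := s4) (l := l2)) //.
- by rewrite -!comp_assoc a3.
- by rewrite -!comp_assoc a3'.
- rewrite el2; symmetry; apply: (ev_pre_map _ (l := l) (s' := s5)).
  + by rewrite -a1; arrows.
  + by rewrite -a1'; arrows.
  + by rewrite -comp_assoc -a2; arrows.
  + by rewrite -comp_assoc -a2'; arrows.
  + by rewrite es4 es3 -es1.
  + by rewrite es5.
Qed.

Lemma associator_map_natural_l (w x y z : ob S) (h h' : fraction y z)
  (g : fraction x y) (f : fraction w x) (t : fraction_map h h') :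
  vcomp_map (pre_map (pre_map t g) f) (associator_map h' g f) =
  vcomp_map (associator_map h g f) (pre_map t (comp_fraction g f)).
Proof.
have [al [[a1 [a2 a3]] ia]] := associator_map_induced h g f.
have [al' [[a1' [a2' a3']] ia']] := associator_map_induced h' g f.
have [eb _] := ia; have [eb' _] := ia'.
apply: (ev_inj_along (r := comp_fraction (comp_fraction h' g) f)
  (c := al') eb').
move=> v a b s; apply: tot_inj.
have [s1 es1] : exists s1 : back (comp_fraction (comp_fraction h g) f) ∘ a ⇒
    back (comp_fraction (comp_fraction h' g) f) ∘ b, tot s1 = tot s.
  by apply: cast_ex; rewrite -?eb' //; arrows.
have [s3 es3] : exists s3 :
    back (comp_fraction h (comp_fraction g f)) ∘ (al ∘ a) ⇒
    back (comp_fraction h' (comp_fraction g f)) ∘ (al' ∘ b), tot s3 = tot s.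
  by apply: cast_ex; rewrite // -eb; arrows.
rewrite (ev_induced_r _ ia' es1) (ev_induced_l _ ia es3).
have [l [s2 [el es2]]] := pre_data s1.
have [l2 [s4 [el2 es4]]] := pre_data s2.
have [l3 [s5 [el3 es5]]] := pre_data s3.
rewrite (ev_pre_map _ (l := l) (s' := s2)) //.
rewrite (ev_pre_map _ (l := l2) (s' := s4)) //.
have E1 : tot (pr1 (link f g) ◁ l3) = tot l.
  apply: (lift_inj (J_back f)); first by rewrite -a1; arrows.
    by rewrite -a1'; arrows.
  by rewrite el es1 -es3 -el3 /=; whiskers.
have E2 : tot (pr2 (link f g) ◁ l3) = tot l2.
  apply: (lift_inj (J_back g));
    first by rewrite -[in RHS]comp_assoc -a2; arrows.
    by rewrite -[in RHS]comp_assoc -a2'; arrows.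
  by rewrite el2 es2 (tot_lw _ l) -E1; whiskers; rewrite total_link.
symmetry; apply: (ev_pre_map _ (l := l3) (s' := s4)) => //.
- by rewrite -!comp_assoc a3.
- by rewrite -!comp_assoc a3'.
- by rewrite es4 (tot_lw _ l2) -E2 /=; whiskers.
Qed.

(** Both sides are induced, by 1-arrows with the same projections; so are the
    two sides of the pentagon below. *)
Lemma triangle_map (x y z : ob S) (g : fraction y z) (f : fraction x y) :
  vcomp_map (associator_map g (id_fraction y) f) (post_map (lunitor_map f) g) =
  pre_map (runitor_map g) f.
Proof.
have [al [[a1 [a2 a3]] ia]] := associator_map_induced g (id_fraction y) f.
have il := lunitor_map_induced f; have ir := runitor_map_induced g.
have [_ [ef _]] := il; have [eb _] := ir.
have [c [c1 c2]] := link_pair (p := f) (q := g)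
  (a := pr1 (link f (id_fraction y)) ∘
        pr1 (link (comp_fraction (id_fraction y) f) g))
  (b := pr2 (link (comp_fraction (id_fraction y) f) g))
  ltac:(by rewrite -comp_assoc ef /link square).
have [d [d1 d2]] := link_pair (p := f) (q := g)
  (a := pr1 (link f (comp_fraction g (id_fraction y))))
  (b := pr2 (link (id_fraction y) g) ∘
        pr2 (link f (comp_fraction g (id_fraction y))))
  ltac:(by rewrite -comp_assoc eb /link square).
have ic := induced_comp ia (induced_post (c' := c) il c1 c2).
have id := induced_pre (c' := d) ir d1 d2.
have E : c ∘ al = d.
  apply: link_eq.
    by rewrite -comp_assoc c1 d1 -a1; arrows.
  by rewrite -comp_assoc c2 d2 a3.
by rewrite E in ic; apply: induced_uniq ic id.
Qed.

Lemma pentagon_map (v w x y z : ob S) (k : fraction y z) (h : fraction x y)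
  (g : fraction w x) (f : fraction v w) :
  vcomp_map (associator_map (comp_fraction k h) g f)
         (associator_map k h (comp_fraction g f)) =
  vcomp_map (vcomp_map (pre_map (associator_map k h g) f)
                 (associator_map k (comp_fraction h g) f))
         (post_map (associator_map h g f) k).
Proof.
have [m1 [[m11 [m12 m13]] i1]] := associator_map_induced (comp_fraction k h) g f.
have [m2 [[m21 [m22 m23]] i2]] := associator_map_induced k h (comp_fraction g f).
have [m3 [[m31 [m32 m33]] i3]] := associator_map_induced k h g.
have [m4 [[m41 [m42 m43]] i4]] := associator_map_induced k (comp_fraction h g) f.
have [m5 [[m51 [m52 m53]] i5]] := associator_map_induced h g f.
have [eb3 _] := i3; have [_ [ef5 _]] := i5.
have [c [c1 c2]] := link_pair (p := f)
  (q := comp_fraction k (comp_fraction h g))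
  (a := pr1 (link f (comp_fraction (comp_fraction k h) g)))
  (b := m3 ∘ pr2 (link f (comp_fraction (comp_fraction k h) g)))
  ltac:(by rewrite -comp_assoc eb3 /link square).
have [d [d1 d2]] := link_pair (q := k)
  (p := comp_fraction h (comp_fraction g f))
  (a := m5 ∘ pr1 (link (comp_fraction (comp_fraction h g) f) k))
  (b := pr2 (link (comp_fraction (comp_fraction h g) f) k))
  ltac:(by rewrite -comp_assoc ef5 /link square).
have il := induced_comp i1 i2.
have ir := induced_comp (induced_comp (induced_pre (c' := c) i3 c1 c2) i4)
  (induced_post (c' := d) i5 d1 d2).
have E : m2 ∘ m1 = d ∘ (m4 ∘ c).
  apply: (link_eq (p := comp_fraction h (comp_fraction g f)) (q := k));
    [apply: (link_eq (p := comp_fraction g f) (q := h));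
      [apply: (link_eq (p := f) (q := g)) |] |];
    by rewrite ?(comp_assoc, c1, c2, m11, m12, m13,
      comp_assoc_eq d1, comp_assoc_eq d2, comp_assoc_eq m23,
      comp_assoc_eq m33, comp_assoc_eq m43, comp_assoc_eq m53,
      comp_assoc_eq3 m21, comp_assoc_eq3 m22, comp_assoc_eq3 m31,
      comp_assoc_eq3 m32, comp_assoc_eq3 m41, comp_assoc_eq3 m42,
      comp_assoc_eq3 m51, comp_assoc_eq3 m52).
by rewrite E in il; apply: induced_uniq il ir.
Qed.


(** * Agreement with the explicit formulas *)

Lemma canonical_liftP (u a b : ob S) (p : hom u a) (Jp : J p) (k l : hom b u)
  (r : k ⇒ l) : tot (p ◁ r) = total_id (p ∘ k) -> is_canonical_lift p r.
Proof.
move=> e; split; first by apply/cell_eq_tot.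
move=> r' /cell_eq_tot e'; apply/tot_inj/(lift_inj Jp) => //.
by rewrite e e'.
Qed.

Lemma canonical_lift_inv (v w x : ob S) (X : hom v x) (JX : J X)
  (m n : hom w v) : X ∘ m = X ∘ n ->
  exists (k : m ⇒ n) (k' : n ⇒ m),
    is_canonical_lift X k /\ is_canonical_lift X k' /\ k • k' = id2 m.
Proof.
move=> e.
have [k ek] := lift_ex JX (id2 (X ∘ m)) eq_refl e.
have [k' ek'] := lift_ex JX (id2 (X ∘ m)) e eq_refl.
exists k, k'; split; first exact: (canonical_liftP JX ek).
split; first by apply: (canonical_liftP JX); rewrite ek' e.
by apply/tot_inj/(lift_inj JX); rewrite ?lwhisk_V // (tot_absorb_l _ ek) ek'; whiskers.
Qed.

(** Pulling X back along X ∘ c covers v by an n in J, and n is isomorphic to a 1-arrow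
    that factors through c; hence whiskering with c is faithful because
    whiskering with n is. *)
Lemma whisk_faithful (w v x y : ob S) (X : hom v x) (c : hom w v)
  (JX : J X) (Jc : J (X ∘ c)) (g h : hom v y) (s s' : g ⇒ h) :
  tot (s ▷ c) = tot (s' ▷ c) -> s = s'.
Proof.
move=> e; have [w' [n [b [Jn en]]]] := cover X Jc.
have [d [d' [_ [_ E]]]] : exists (d : n ⇒ c ∘ b) (d' : c ∘ b ⇒ n),
    is_canonical_lift X d /\ is_canonical_lift X d' /\ d • d' = id2 n.
  by apply: (canonical_lift_inv JX); rewrite en comp_assoc.
have H (z : g ⇒ h) : z ▷ n = g ◁ d • z ▷ (c ∘ b) • h ◁ d'.
  rewrite (interchange (two_laws S)) -vcompA -lwhisk_V E.
  by rewrite (lwhisk_id (two_laws S)) vcomp_idr.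
apply/tot_inj/(descent_inj Jn) => //.
rewrite !H; apply: tot_vcomp => //; apply: tot_vcomp => //.
by move: e; rewrite !tot_rw !total_rw_comp => ->.
Qed.

Lemma id_map_spec (x y : ob S) (p : fraction x y) : is_identity_map (id_map p).
Proof.
have [s es] := idcell_ex (meet_square p p).
have [l el] : exists l : pr1 (meet p p) ⇒ pr2 (meet p p),
    tot (back p ◁ l) = tot s.
  by apply: (lift_ex (J_back p)) => //; exact: meet_square.
exists l; split; first by apply: (canonical_liftP (J_back p)); rewrite el.
by apply: tot_inj; rewrite -(ev_projections (id_map p) es) -(tot_inj el) ev_id_map.
Qed.

Lemma meet_pair (x y z : ob S) (p : fraction x y) (q : fraction x z) (w : ob S)
  (a : hom w (fapex p)) (b : hom w (fapex q)) : back p ∘ a = back q ∘ b ->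
  exists c : hom w (apex (meet p q)),
    pr1 (meet p q) ∘ c = a /\ pr2 (meet p q) ∘ c = b.
Proof. exact: pair_ex. Qed.

Lemma ev_at (x y : ob S) (p q : fraction x y) (t : fraction_map p q) (w : ob S)
  (c : hom w (apex (meet p q))) (a : hom w (fapex p)) (b : hom w (fapex q))
  (s : back p ∘ a ⇒ back q ∘ b) f :
  pr1 (meet p q) ∘ c = a -> pr2 (meet p q) ∘ c = b -> tot s = total_id f ->
  tot (ev t s) = tot (t ▷ c).
Proof. by move=> ? ?; subst; exact: ev_pairing. Qed.

Lemma vcomp_map_spec (x y : ob S) (p1 p2 p3 : fraction x y)
  (t1 : fraction_map p1 p2) (t2 : fraction_map p2 p3) :
  is_vertical_composite t1 t2 (vcomp_map t1 t2).
Proof.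
rewrite /is_vertical_composite.
set T := pb _ _.
have sq : back p1 ∘ pr1 (meet p1 p2) ∘ pr1 T = back p3 ∘ pr2 T by exact: square.
have [m13 [e1 e3]] : exists m : hom (apex T) (apex (meet p1 p3)),
    pr1 (meet p1 p3) ∘ m = pr1 (meet p1 p2) ∘ pr1 T /\
    pr2 (meet p1 p3) ∘ m = pr2 T.
  by apply: meet_pair; rewrite -comp_assoc.
have [m23 [e2 e3']] : exists m : hom (apex T) (apex (meet p2 p3)),
    pr1 (meet p2 p3) ∘ m = pr2 (meet p1 p2) ∘ pr1 T /\
    pr2 (meet p2 p3) ∘ m = pr2 T.
  by apply: meet_pair; rewrite -comp_assoc -meet_square.
have e : (fwd p2 ∘ pr2 (meet p1 p2)) ∘ pr1 T =
         (fwd p2 ∘ pr1 (meet p2 p3)) ∘ m23 by rewrite !comp_assoc e2.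
exists m13, m23, e; do 2 split=> //.
have [s1 es1] : exists s1 : back p1 ∘ (pr1 (meet p1 p2) ∘ pr1 T) ⇒
    back p2 ∘ (pr2 (meet p1 p2) ∘ pr1 T), tot s1 = total_id (back p3 ∘ pr2 T).
  rewrite -sq comp_assoc; apply: idcell_ex.
  by rewrite -!comp_assoc meet_square.
have [s2 es2] : exists s2 : back p2 ∘ (pr2 (meet p1 p2) ∘ pr1 T) ⇒
    back p3 ∘ pr2 T, tot s2 = total_id (back p3 ∘ pr2 T).
  have E : back p3 ∘ pr2 T = back p2 ∘ (pr2 (meet p1 p2) ∘ pr1 T).
    by rewrite -sq -comp_assoc meet_square.
  by rewrite E; apply: idcell_ex.
have H : tot (vcomp_map t1 t2 ▷ m13) = tot (vcomp_along e (t1 ▷ pr1 T) (t2 ▷ m23)).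
  rewrite -(ev_at (vcomp_map t1 t2) (s := s1 • s2) (f := back p3 ∘ pr2 T) e1 e3);
    first by rewrite (tot_absorb_l _ es1).
  rewrite ev_vcomp_map; apply: tot_vcomp.
    by rewrite tot_idcell_r; exact: (ev_at t1 eq_refl eq_refl es1).
  by exact: (ev_at t2 e2 e3' es2).
split; first by apply/cell_eq_tot.
move=> t' /cell_eq_tot; rewrite -H => H'.
symmetry; apply: (whisk_faithful (J_meet p1 p3) _ H').
rewrite comp_assoc e1; apply: J_comp; first exact: J_back.
by apply: J_comp; exact: J_pr1.
Qed.

Lemma post_map_spec (x y z : ob S) (p q : fraction x y) (t : fraction_map p q)
  (r : fraction y z) : is_right_whiskering t (post_map t r).
Proof.
rewrite /is_right_whiskering; set P := meet _ _.
have [s es] := idcell_ex (meet_square (comp_fraction r p) (comp_fraction r q)).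
have [s' [l [es' el]]] : exists
    (s' : back p ∘ (pr1 (link p r) ∘ pr1 P) ⇒ back q ∘ (pr1 (link q r) ∘ pr2 P))
    (l : pr2 (link p r) ∘ pr1 P ⇒ pr2 (link q r) ∘ pr2 P),
    tot s' = tot s /\ tot (back r ◁ l) = tot (ev t s') by exact: post_data.
have [m [e1 e2]] : exists m : hom (apex P) (apex (meet p q)),
    pr1 (meet p q) ∘ m = pr1 (link p r) ∘ pr1 P /\
    pr2 (meet p q) ∘ m = pr1 (link q r) ∘ pr2 P.
  apply: meet_pair; rewrite -!comp_assoc.
  exact: (meet_square (comp_fraction r p) (comp_fraction r q)).
rewrite es in es'.
have et := ev_at t e1 e2 es'.
exists m, l; split=> //; split; first split.
- by apply/cell_eq_tot; rewrite el et.
- move=> l' /cell_eq_tot h; apply/tot_inj/(lift_inj (J_back r)) => //.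
  by rewrite el et h.
- apply/cell_eq_tot; rewrite -(ev_projections (post_map t r) es).
  by apply: (ev_post_map (s' := s')); rewrite // es es'.
Qed.

(** Over u the two projections to u agree, so that there the whiskering is the
    restriction of [a].  The formula on the larger pullback over x then follows
    by interchange with the mutually inverse lifts [k] and [k']. *)
Lemma pre_map_spec (x y z : ob S) (p : fraction x y) (q1 q2 : fraction y z)
  (a : fraction_map q1 q2) : is_left_whiskering a (p := p) (pre_map a p).
Proof.
set R1 := restrict (fwd p) q1; set R2 := restrict (fwd p) q2.
have [m [m1 m2]] : exists m : hom (apex (meet R1 R2)) (apex (meet q1 q2)),
    pr1 (meet q1 q2) ∘ m = pr2 (link p q1) ∘ pr1 (meet R1 R2) /\
    pr2 (meet q1 q2) ∘ m = pr2 (link p q2) ∘ pr2 (meet R1 R2).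
  apply: meet_pair; rewrite -!comp_assoc.
  rewrite -(square (fwd p) (J_back q1)) -(square (fwd p) (J_back q2)).
  by rewrite !comp_assoc; congr (_ ∘ _); exact: (meet_square R1 R2).
have [b eb] : exists b : fraction_map R1 R2, tot b = tot (a ▷ m).
  by apply: cast_ex; rewrite !comp_assoc ?m1 ?m2.
exists b; split; first by exists m; split=> //; apply/cell_eq_tot.
rewrite /is_pushforward.
set v := meet R1 R2; set V := meet (push _ _) _.
set JX := J_comp _ _; set W := pb _ _.
have [c [c1 c2]] : exists c : hom (apex v) (apex V),
    pr1 V ∘ c = pr1 v /\ pr2 V ∘ c = pr2 v.
  apply: (pair_ex (f := back p ∘ back R1) (J_back (push (J_back p) R2))).
  by rewrite /= !comp_assoc; congr (_ ∘ _); exact: (meet_square R1 R2).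
set X := (back p ∘ back R1) ∘ pr1 V in JX W *.
have Xc : X ∘ c = back p ∘ back R1 ∘ pr1 v by rewrite /X comp_assoc c1.
have sqW : X ∘ (c ∘ pr1 W) = X ∘ pr2 W.
  by rewrite -comp_assoc Xc; exact: square.
have [k [k' [ek [ek' E]]]] := canonical_lift_inv JX (eq_sym sqW).
have e : (fwd R1 ∘ pr1 V) ∘ (c ∘ pr1 W) = (fwd R1 ∘ pr1 v) ∘ pr1 W.
  by rewrite -c1; arrows.
have e' : (fwd R2 ∘ pr2 v) ∘ pr1 W = (fwd R2 ∘ pr2 V) ∘ (c ∘ pr1 W).
  by rewrite -c2; arrows.
exists c, k, k', e, e'; split=> //.
do 2 (split; first by []).
have es : tot (pre_map a p ▷ c) = tot b.
  have [s es] : exists s : back (comp_fraction q1 p) ∘ pr1 v ⇒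
      back (comp_fraction q2 p) ∘ pr2 v, tot s = total_id (back p ∘ back R1 ∘ pr1 v).
    by apply: idcell_ex; rewrite /= !comp_assoc; congr (_ ∘ _);
      exact: (meet_square R1 R2).
  have [l el] := idcell_ex (meet_square R1 R2).
  have [s' es'] := cast_ex (fwd p ◁ l) (link_square (q := q1) (pr1 v))
    (link_square (q := q2) (pr2 v)).
  rewrite eb -(ev_at (pre_map a p) c1 c2 es) (ev_pre_map _ (l := l) (s' := s')) //.
    by rewrite tot_lw el es total_lw_id comp_assoc.
  apply: (ev_at a m1 m2 (f := fwd p ∘ (back R1 ∘ pr1 v))).
  by rewrite es' tot_lw el total_lw_id.
have H : pre_map a p ▷ pr2 W = vcomp_along e'
    (vcomp_along e ((fwd R1 ∘ pr1 V) ◁ k) (b ▷ pr1 W)) ((fwd R2 ∘ pr2 V) ◁ k').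
  rewrite -[LHS](vcomp_idr (K := S)) -(lwhisk_id (two_laws S)) -E lwhisk_V vcompA.
  rewrite -(interchange (two_laws S)).
  apply: tot_inj; apply: tot_vcomp => //.
  rewrite tot_idcell_r; apply: tot_vcomp; first by rewrite tot_idcell_r.
  by rewrite !tot_rw -es total_rw_comp.
split=> // t' ht'.
apply/tot_inj/(descent_inj (n := pr2 W)) => //; last by rewrite H ht'.
apply: J_pr2.
by apply: J_comp; [exact: (J_comp (J_back p) (J_back R1)) | exact: J_pr1].
Qed.

Lemma associator_map_spec (x1 x2 x3 x4 : ob S) (r : fraction x3 x4)
  (q : fraction x2 x3) (p : fraction x1 x2) :
  is_associator (associator_map r q p).
Proof.
have [al [h [eb [ef hal]]]] := associator_map_induced r q p.
have [s es] := idcell_ex (meet_square (comp_fraction (comp_fraction r q) p)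
  (comp_fraction r (comp_fraction q p))).
have [k ek] := lift_ex (J_back (comp_fraction r (comp_fraction q p))) s
  (a := al ∘ pr1 (meet _ _)) ltac:(by rewrite -comp_assoc eb) eq_refl.
exists al, k; split=> //; split.
  apply: canonical_liftP; first exact: J_back.
  by rewrite ek es -comp_assoc eb.
apply/cell_eq_tot; rewrite -(ev_projections (associator_map r q p) es).
exact: (hal _ _ _ _ _ k).
Qed.

Definition fraction_ops : bicat_ops (fraction_graph S) :=
  @BicatOps (fraction_graph S) id_map vcomp_map
    (fun x y z f g h a => post_map a f)
    (fun x y z g h a f => pre_map a f)
    lunitor_map runitor_map
    (fun w x y z h g f => associator_map h g f).

Lemma fraction_bicategory : is_bicategory fraction_ops.
Proof.
split.
- exact: id_map_vcomp.
- exact: vcomp_map_id.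
- exact: vcomp_map_assoc.
- by move=> x y z f g; exact: post_map_id.
- by move=> x y z f g h k a b; exact: post_map_vcomp.
- by move=> x y z g f; exact: pre_map_id.
- by move=> x y z g h k a b f; exact: pre_map_vcomp.
- by move=> x y z f f' g g' a b; exact: interchange_map.
- exact: lunitor_map_natural.
- exact: runitor_map_natural.
- by move=> w x y z h g f f' a; exact: associator_map_natural_r.
- by move=> w x y z h g g' f a; exact: associator_map_natural_m.
- by move=> w x y z h h' g f a; exact: associator_map_natural_l.
- by move=> x y f; exact: induced_iso (lunitor_map_induced f).
- by move=> x y f; exact: induced_iso (runitor_map_induced f).
- move=> w x y z h g f; have [al [_ i]] := associator_map_induced h g f.
  exact: induced_iso i.
- by move=> x y z g f; exact: triangle_map.
- by move=> v w x y z k h g f; exact: pentagon_map.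
Qed.

End Bicategory.

Theorem proposition3p20 (S : two_site) :
  exists B : bicat_ops (fraction_graph S),
    is_bicategory B /\
    (forall (x y : ob (fraction_graph S)) (p : hom x y),
       is_identity_map (id2 p)) /\
    (forall (x y : ob (fraction_graph S)) (p1 p2 p3 : hom x y)
            (t1 : p1 ⇒ p2) (t2 : p2 ⇒ p3),
       is_vertical_composite t1 t2 (t1 • t2)) /\
    (forall (x y z : ob (fraction_graph S)) (p : hom x y) (q1 q2 : hom y z)
            (t : q1 ⇒ q2),
       is_left_whiskering t (p := p) (t ▷ p)) /\
    (forall (x y z : ob (fraction_graph S)) (p1 p2 : hom x y) (t : p1 ⇒ p2)
            (q : hom y z),
       is_right_whiskering t (q ◁ t)) /\
    (forall (x y : ob (fraction_graph S)) (p : hom x y),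
       (exists e : id1 y ∘ p = p, lunitor p = idcell e) /\
       (exists e : p ∘ id1 x = p, runitor p = idcell e)) /\
    (forall (x1 x2 x3 x4 : ob (fraction_graph S))
            (r : hom x3 x4) (q : hom x2 x3) (p : hom x1 x2),
       is_associator (associator r q p)).
Proof.
exists (fraction_ops S); split; first exact: fraction_bicategory.
split; first exact: id_map_spec.
split; first by move=> x y p1 p2 p3 t1 t2; exact: vcomp_map_spec.
split; first by move=> x y z p q1 q2 t; exact: pre_map_spec.
split; first by move=> x y z p1 p2 t q; exact: post_map_spec.
split; last by move=> x1 x2 x3 x4 r q p; exact: associator_map_spec.
move=> x y p; split.
  by exists (comp_fraction_id_l p).
by exists (comp_fraction_id_r p).
Qed.
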